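(* Let $K$ be a field with $\mathrm{char}(K)\neq 2$, and let $\mathfrak{h}=\mathfrak{n}_{m,3}$ be the free nilpotent Lie algebra over $K$ of rank $m$ and class $3$. Then $L(\mathfrak{h})$ is a central extension of $K^{m\binom{m}{2}}$ by $\mathfrak{n}_{m,4}\oplus\mathfrak{n}_{\binom{m}{2},2}$; that is, there is a central ideal $Z$ of $L(\mathfrak{h})$ with $\dim_K Z=m\binom{m}{2}$ and $L(\mathfrak{h})/Z\cong \mathfrak{n}_{m,4}\oplus\mathfrak{n}_{\binom{m}{2},2}$. In particular, $\chi(\mathfrak{h})$ is nilpotent of class exactly $4$.
   Context: For a Lie algebra $\mathfrak{g}$ over $K$, let $\mathfrak{g}^{\psi}$ be an isomorphic copy of $\mathfrak{g}$ via $x\mapsto x^{\psi}$, and let $\chi(\mathfrak{g})=\langle \mathfrak{g},\mathfrak{g}^{\psi} \mid [x,x^{\psi}]=0 \text{ for all } x\in\mathfrak{g}\rangle$ (the quotient of the free product of the Lie algebras $\mathfrak{g}$ and $\mathfrak{g}^{\psi}$ by the ideal generated by all $[x,x^{\psi}]$). Let $\alpha:\chi(\mathfrak{g})\to\mathfrak{g}$ be the homomorphism with $\alpha(x)=\alpha(x^{\psi})=x$ for all $x\in\mathfrak{g}$, and $L(\mathfrak{g})=\ker(\alpha)$. The free nilpotent Lie algebra of rank $r$ and class $c$ is $\mathfrak{n}_{r,c}=F/\gamma_{c+1}(F)$, where $F$ is a free Lie algebra of rank $r$ over $K$ and $\gamma_1(F)=F$, $\gamma_{k+1}(F)=[F,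\gamma_k(F)]$.
   Formalization: The claim that χ(h) is nilpotent of class exactly 4 is stated only for m ≥ 2, since it fails for m = 0 (χ(h) = 0) and m = 1 (χ(h) = K², abelian); the central extension claim is stated for every m. *)

(* Defs.v *)
From HB Require Import structures.
From mathcomp Require Import all_boot all_order all_algebra.
From mathcomp Require Import boolp.

Set Implicit Arguments.
Unset Strict Implicit.
Unset Printing Implicit Defensive.

Import GRing.Theory.
Local Open Scope ring_scope.
Local Open Scope quotient_scope.

HB.mixin Record Lmodule_isLieAlgebra (K : fieldType) V of GRing.Lmodule K V := {
  lie : V -> V -> V;
  lie_linearl : forall y, linear (lie^~ y);
  lie_linearr : forall x, linear (lie x);
  liexx : forall x, lie x x = 0;
  lie_jacobi : forall x y z,
    lie x (lie y z) + lie y (lie z x) + lie z (lie x y) = 0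
}.

#[short(type="lieAlgType")]
HB.structure Definition LieAlgebra (K : fieldType) :=
  {V of GRing.Lmodule K V & Lmodule_isLieAlgebra K V}.

HB.mixin Record isLieMorphism (K : fieldType) (A B : lieAlgType K)
    (f : A -> B) := {
  lie_morph : {morph f : x y / lie x y >-> lie x y}
}.

#[short(type="lieHom")]
HB.structure Definition LieMorphism (K : fieldType) (A B : lieAlgType K) :=
  {f of @GRing.Linear K A B *:%R f & isLieMorphism K A B f}.

Definition lie_isomorphic (K : fieldType) (A B : lieAlgType K) : Prop :=
  exists f : lieHom A B, bijective f.

HB.mixin Record isLieIdeal (K : fieldType) (L : lieAlgType K)
    (I : L -> bool) := {
  lie_ideal_subproof : forall x, {in I, forall y, lie x y \in I}
}.

#[short(type="lieIdeal")]
HB.structure Definition LieIdeal (K : fieldType) (L : lieAlgType K) :=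
  {I of @GRing.SubmodClosed K L I & isLieIdeal K L I}.

Section IdealZmodClosed.
Variables (K : fieldType) (L : lieAlgType K) (I : lieIdeal L).

Lemma lie_ideal_opp : oppr_closed (I : {pred L}).
Proof. by move=> x xI; rewrite -scaleN1r rpredZ. Qed.
HB.instance Definition _ := GRing.isOppClosed.Build L (LieIdeal.sort I)
  lie_ideal_opp.

End IdealZmodClosed.

Section Basics.
Variables (K : fieldType) (L : lieAlgType K).
Implicit Types (x y z : L) (I : lieIdeal L).

Lemma lieDl x y z : lie (x + y) z = lie x z + lie y z.
Proof. by have := lie_linearl z 1 x y; rewrite /= !scale1r. Qed.

Lemma lieDr x y z : lie z (x + y) = lie z x + lie z y.
Proof. by have := lie_linearr z 1 x y; rewrite /= !scale1r. Qed.

Lemma lie0x x : lie 0 x = 0.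
Proof. by apply: (addrI (lie 0 x)); rewrite -lieDl !addr0. Qed.

Lemma liex0 x : lie x 0 = 0.
Proof. by apply: (addrI (lie x 0)); rewrite -lieDr !addr0. Qed.

Lemma lieZl a x y : lie (a *: x) y = a *: lie x y.
Proof. by have := lie_linearl y a x 0; rewrite /= lie0x !addr0. Qed.

Lemma lieZr a x y : lie y (a *: x) = a *: lie y x.
Proof. by have := lie_linearr y a x 0; rewrite /= liex0 !addr0. Qed.

Lemma lieNl x y : lie (- x) y = - lie x y.
Proof. by rewrite -scaleN1r lieZl scaleN1r. Qed.

Lemma lieNr x y : lie y (- x) = - lie y x.
Proof. by rewrite -scaleN1r lieZr scaleN1r. Qed.

Lemma lieC x y : lie x y = - lie y x.
Proof.
have := liexx (x + y); rewrite lieDl !lieDr !liexx add0r addr0.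
by move/eqP; rewrite addr_eq0 => /eqP.
Qed.

Lemma lie_idealr I x y : y \in I -> lie x y \in I.
Proof. exact: lie_ideal_subproof. Qed.

Lemma lie_ideall I x y : x \in I -> lie x y \in I.
Proof. by move=> xI; rewrite lieC rpredN lie_idealr. Qed.

End Basics.

Section Ideals.
Variables (K : fieldType) (L : lieAlgType K).

Definition lie_full : {pred L} := predT.

Lemma lie_full_submod : submod_closed lie_full. Proof. by []. Qed.
HB.instance Definition _ := GRing.isSubmodClosed.Build K L lie_full
  lie_full_submod.
Lemma lie_full_ideal x : {in lie_full, forall y, lie x y \in lie_full}.
Proof. by []. Qed.
HB.instance Definition _ := isLieIdeal.Build K L lie_full lie_full_ideal.

Definition ideal_gen (S : L -> Prop) : {pred L} :=
  fun x => `[< forall I : lieIdeal L, (forall s, S s -> s \in I) -> x \in I >].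

Lemma ideal_gen_submod S : submod_closed (ideal_gen S).
Proof.
split=> [|a u v /asboolP uI /asboolP vI]; apply/asboolP => I SI.
  exact: rpred0.
by rewrite rpredD ?rpredZ ?uI ?vI.
Qed.
HB.instance Definition _ S := GRing.isSubmodClosed.Build K L (ideal_gen S)
  (ideal_gen_submod S).
Lemma ideal_gen_ideal S x : {in ideal_gen S, forall y, lie x y \in ideal_gen S}.
Proof.
by move=> y /asboolP yI; apply/asboolP => I SI; rewrite lie_idealr ?yI.
Qed.
HB.instance Definition _ S := isLieIdeal.Build K L (ideal_gen S)
  (@ideal_gen_ideal S).

Lemma mem_ideal_gen (S : L -> Prop) s : S s -> s \in ideal_gen S.
Proof. by move=> Ss; apply/asboolP => I; apply. Qed.

Lemma ideal_gen_sub (S : L -> Prop) (I : lieIdeal L) :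
  (forall s, S s -> s \in I) -> {subset ideal_gen S <= I}.
Proof. by move=> SI x /asboolP; apply. Qed.

(* [L, I], the linear span of the brackets of elements of L and I *)
Definition lie_comm (I : lieIdeal L) : {pred L} := fun x =>
  `[< forall W : submodClosed L,
        (forall y z, z \in I -> lie y z \in W) -> x \in W >].

Lemma lie_comm_submod I : submod_closed (lie_comm I).
Proof.
split=> [|a u v /asboolP uW /asboolP vW]; apply/asboolP => W IW.
  exact: rpred0.
by rewrite rpredD ?rpredZ ?uW ?vW.
Qed.
HB.instance Definition _ I := GRing.isSubmodClosed.Build K L (lie_comm I)
  (lie_comm_submod I).
Lemma lie_comm_ideal I x : {in lie_comm I, forall y, lie x y \in lie_comm I}.
Proof.
move=> y /asboolP/(_ I) yI; apply/asboolP => W; apply; apply: yI => u v.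
exact: lie_idealr.
Qed.
HB.instance Definition _ I := isLieIdeal.Build K L (lie_comm I)
  (@lie_comm_ideal I).

(* gamma 1 is L; gamma 0 is also L, but is not meaningful *)
Definition gamma (k : nat) : lieIdeal L :=
  iter k.-1 (fun I : lieIdeal L => lie_comm I) lie_full.

Definition nilpotent_of_class (c : nat) : Prop :=
  (forall x, x \in gamma c.+1 -> x = 0) /\
  (forall k, (k < c)%N -> exists2 x, x \in gamma k.+1 & x != 0).

Definition central (I : lieIdeal L) : Prop :=
  forall x z, z \in I -> lie x z = 0.

End Ideals.

(* The submodule W has a basis of n vectors; the ambient space is possibly
   infinite-dimensional, so that vectType does not apply. *)
Definition has_dim (K : fieldType) (V : lmodType K) (W : submodClosed V)
    (n : nat) : Prop :=
  exists b : 'I_n -> V,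
    [/\ forall i, b i \in W,
        forall c : 'I_n -> K, \sum_i c i *: b i = 0 -> forall i, c i = 0
      & forall v, v \in W -> exists c : 'I_n -> K, v = \sum_i c i *: b i].

Section Kernel.
Variables (K : fieldType) (A B : lieAlgType K) (f : lieHom A B).

Definition lie_ker : {pred A} := fun x => f x == 0.

Lemma lie_ker_submod : submod_closed lie_ker.
Proof.
split=> [|a u v /eqP fu /eqP fv]; apply/eqP; first by rewrite raddf0.
by rewrite linearP /= fu fv scaler0 addr0.
Qed.
HB.instance Definition _ := GRing.isSubmodClosed.Build K A lie_ker
  lie_ker_submod.
Lemma lie_ker_ideal x : {in lie_ker, forall y, lie x y \in lie_ker}.
Proof. by move=> y /eqP fy; apply/eqP; rewrite lie_morph fy liex0. Qed.
HB.instance Definition _ := isLieIdeal.Build K A lie_ker lie_ker_ideal.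

End Kernel.

Section IdealAsAlgebra.
Variables (K : fieldType) (L : lieAlgType K) (I : lieIdeal L).

Record ideal_alg := IdealAlg { ideal_val : L; ideal_valP : ideal_val \in I }.

HB.instance Definition _ := [isSub for ideal_val].
HB.instance Definition _ := [Choice of ideal_alg by <:].
HB.instance Definition _ := [SubChoice_isSubLmodule of ideal_alg by <:].

Definition ideal_lie (x y : ideal_alg) : ideal_alg :=
  IdealAlg (lie_idealr (val x) (valP y)).

Lemma ideal_lie_linearl y : linear (ideal_lie^~ y).
Proof.
by move=> a u v; apply: val_inj; apply: lie_linearl.
Qed.
Lemma ideal_lie_linearr x : linear (ideal_lie x).
Proof.
by move=> a u v; apply: val_inj; apply: lie_linearr.
Qed.
Lemma ideal_liexx x : ideal_lie x x = 0.
Proof. by apply: val_inj; apply: liexx. Qed.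
Lemma ideal_lie_jacobi x y z : ideal_lie x (ideal_lie y z)
  + ideal_lie y (ideal_lie z x) + ideal_lie z (ideal_lie x y) = 0.
Proof. by apply: val_inj; apply: lie_jacobi. Qed.
HB.instance Definition _ := Lmodule_isLieAlgebra.Build K ideal_alg
  ideal_lie_linearl ideal_lie_linearr ideal_liexx ideal_lie_jacobi.

End IdealAsAlgebra.

Section DirectSum.
Variables (K : fieldType) (A B : lieAlgType K).

Definition pair_lie (x y : A * B) : A * B := (lie x.1 y.1, lie x.2 y.2).

Lemma pair_lie_linearl y : linear (pair_lie^~ y).
Proof.
by move=> a u v; congr pair; rewrite /= lieDl lieZl.
Qed.
Lemma pair_lie_linearr x : linear (pair_lie x).
Proof.
by move=> a u v; congr pair; rewrite /= lieDr lieZr.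
Qed.
Lemma pair_liexx x : pair_lie x x = 0.
Proof. by congr pair; rewrite liexx. Qed.
Lemma pair_lie_jacobi x y z : pair_lie x (pair_lie y z)
  + pair_lie y (pair_lie z x) + pair_lie z (pair_lie x y) = 0.
Proof. by congr pair; rewrite /= lie_jacobi. Qed.
HB.instance Definition _ := Lmodule_isLieAlgebra.Build K (A * B)%type
  pair_lie_linearl pair_lie_linearr pair_liexx pair_lie_jacobi.

End DirectSum.

Section Quotient.
Variables (K : fieldType) (L : lieAlgType K) (I : lieIdeal L).

Definition lie_quot : Type := Quotient.quot I.

HB.instance Definition _ := GRing.Zmodule.on lie_quot.

Definition lie_pi (x : L) : lie_quot := \pi_(Quotient.quot I) x.

Lemma lie_pi_eq x y : (lie_pi x == lie_pi y) = (x - y \in I).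
Proof. by rewrite Quotient.idealrBE. Qed.

Lemma lie_piK (q : lie_quot) : lie_pi (repr (q : Quotient.quot I)) = q.
Proof. exact: reprK. Qed.

Lemma lie_piD x y : lie_pi (x + y) = lie_pi x + lie_pi y.
Proof. by rewrite /lie_pi !piE. Qed.

Lemma lie_pi0 : lie_pi 0 = 0.
Proof. by rewrite /lie_pi !piE. Qed.

Lemma repr_pi x : repr (lie_pi x : Quotient.quot I) - x \in I.
Proof. by rewrite -lie_pi_eq lie_piK. Qed.

Definition quot_scale (a : K) (q : lie_quot) : lie_quot :=
  lie_pi (a *: repr (q : Quotient.quot I)).

Definition quot_lie (p q : lie_quot) : lie_quot :=
  lie_pi (lie (repr (p : Quotient.quot I)) (repr (q : Quotient.quot I))).

Lemma lie_piZ a x : quot_scale a (lie_pi x) = lie_pi (a *: x).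
Proof. by apply/eqP; rewrite lie_pi_eq -scalerBr rpredZ ?repr_pi. Qed.

Lemma lie_pi_lie x y : quot_lie (lie_pi x) (lie_pi y) = lie_pi (lie x y).
Proof.
apply/eqP; rewrite lie_pi_eq.
set u := repr _; set v := repr _.
have -> : lie u v - lie x y = lie (u - x) v + lie x (v - y).
  by rewrite lieDl lieDr lieNl lieNr addrA subrK.
by apply: rpredD; [apply: lie_ideall|apply: lie_idealr]; apply: repr_pi.
Qed.

Lemma quotW (P : lie_quot -> Prop) : (forall x, P (lie_pi x)) -> forall q, P q.
Proof. by move=> Ppi q; rewrite -(lie_piK q). Qed.

Lemma quot_scaleA a b q : quot_scale a (quot_scale b q) = quot_scale (a * b) q.
Proof. by elim/quotW: q => x; rewrite !lie_piZ scalerA. Qed.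
Lemma quot_scale1 : left_id 1 quot_scale.
Proof. by elim/quotW => x; rewrite !lie_piZ scale1r. Qed.
Lemma quot_scaleDr : right_distributive quot_scale +%R.
Proof.
move=> a; elim/quotW => x; elim/quotW => y.
by rewrite -lie_piD !lie_piZ -lie_piD scalerDr.
Qed.
Lemma quot_scaleDl q : {morph quot_scale^~ q : a b / a + b}.
Proof. by elim/quotW: q => x a b; rewrite !lie_piZ -lie_piD scalerDl. Qed.
HB.instance Definition _ := GRing.Zmodule_isLmodule.Build K lie_quot
  quot_scaleA quot_scale1 quot_scaleDr quot_scaleDl.

Lemma quot_lie_linearl q : linear (quot_lie^~ q).
Proof.
elim/quotW: q => z a; elim/quotW => x; elim/quotW => y /=.
by rewrite [a *: lie_pi x]lie_piZ -lie_piD !lie_pi_lie [a *: lie_pi _]lie_piZ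
  -lie_piD lieDl lieZl.
Qed.
Lemma quot_lie_linearr p : linear (quot_lie p).
Proof.
elim/quotW: p => z a; elim/quotW => x; elim/quotW => y /=.
by rewrite [a *: lie_pi x]lie_piZ -lie_piD !lie_pi_lie [a *: lie_pi _]lie_piZ
  -lie_piD lieDr lieZr.
Qed.
Lemma quot_liexx q : quot_lie q q = 0.
Proof. by elim/quotW: q => x; rewrite lie_pi_lie liexx lie_pi0. Qed.
Lemma quot_lie_jacobi p q r : quot_lie p (quot_lie q r)
  + quot_lie q (quot_lie r p) + quot_lie r (quot_lie p q) = 0.
Proof.
elim/quotW: p => x; elim/quotW: q => y; elim/quotW: r => z.
by rewrite !lie_pi_lie -!lie_piD lie_jacobi lie_pi0.
Qed.
HB.instance Definition _ := Lmodule_isLieAlgebra.Build K lie_quot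
  quot_lie_linearl quot_lie_linearr quot_liexx quot_lie_jacobi.

Lemma lie_pi_is_linear : linear lie_pi.
Proof. by move=> a x y; rewrite lie_piD [a *: lie_pi x]lie_piZ. Qed.
HB.instance Definition _ := GRing.isLinear.Build K L lie_quot _ lie_pi
  lie_pi_is_linear.
Lemma lie_pi_is_lie : {morph lie_pi : x y / lie x y >-> lie x y}.
Proof. by move=> x y; rewrite -lie_pi_lie. Qed.
HB.instance Definition _ := isLieMorphism.Build K L lie_quot lie_pi
  lie_pi_is_lie.

Section Lift.
Variables (M : lieAlgType K) (f : lieHom L M).

(* The proof argument is unused in the body, but lets the morphism instances
   below be inferred. *)
Definition quot_lift of {subset I <= lie_ker f} : lie_quot -> M :=
  fun q => f (repr (q : Quotient.quot I)).

Hypothesis fI : {subset I <= lie_ker f}.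

Lemma quot_liftE x : quot_lift fI (lie_pi x) = f x.
Proof.
apply/eqP; rewrite -subr_eq0 -raddfB.
exact: fI (repr_pi x).
Qed.
Lemma quot_lift_is_linear : linear (quot_lift fI).
Proof.
move=> a; elim/quotW => x; elim/quotW => y.
by rewrite -linearP !quot_liftE linearP.
Qed.
Lemma quot_lift_is_lie : {morph quot_lift fI : x y / lie x y >-> lie x y}.
Proof.
elim/quotW => x; elim/quotW => y.
by rewrite -lie_morph !quot_liftE lie_morph.
Qed.
HB.instance Definition _ := GRing.isLinear.Build K lie_quot M _ (quot_lift fI)
  quot_lift_is_linear.
HB.instance Definition _ := isLieMorphism.Build K lie_quot M (quot_lift fI)
  quot_lift_is_lie.

End Lift.
End Quotient.

(* Formal Lie expressions in the generators X, modulo the least congruence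
   containing the axioms of Lie algebras over K. *)

Section FreeLie.
Variables (K : fieldType) (X : Type).

Inductive lterm : Type :=
| LVar of X
| LZero
| LOpp of lterm
| LAdd of lterm & lterm
| LScale of K & lterm
| LLie of lterm & lterm.

Inductive lterm_eq : lterm -> lterm -> Prop :=
| leq_refl x : lterm_eq x x
| leq_sym x y : lterm_eq x y -> lterm_eq y x
| leq_trans x y z : lterm_eq x y -> lterm_eq y z -> lterm_eq x z
| leq_opp x x' : lterm_eq x x' -> lterm_eq (LOpp x) (LOpp x')
| leq_add x x' y y' : lterm_eq x x' -> lterm_eq y y' ->
    lterm_eq (LAdd x y) (LAdd x' y')
| leq_scale a x x' : lterm_eq x x' -> lterm_eq (LScale a x) (LScale a x')
| leq_lie x x' y y' : lterm_eq x x' -> lterm_eq y y' ->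
    lterm_eq (LLie x y) (LLie x' y')
| leq_addA x y z : lterm_eq (LAdd x (LAdd y z)) (LAdd (LAdd x y) z)
| leq_addC x y : lterm_eq (LAdd x y) (LAdd y x)
| leq_add0 x : lterm_eq (LAdd LZero x) x
| leq_addN x : lterm_eq (LAdd (LOpp x) x) LZero
| leq_scaleA a b x : lterm_eq (LScale a (LScale b x)) (LScale (a * b) x)
| leq_scale1 x : lterm_eq (LScale 1 x) x
| leq_scaleDr a x y :
    lterm_eq (LScale a (LAdd x y)) (LAdd (LScale a x) (LScale a y))
| leq_scaleDl a b x :
    lterm_eq (LScale (a + b) x) (LAdd (LScale a x) (LScale b x))
| leq_lie_linearl a x y z : lterm_eq (LLie (LAdd (LScale a x) y) z)
    (LAdd (LScale a (LLie x z)) (LLie y z))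
| leq_lie_linearr a x y z : lterm_eq (LLie z (LAdd (LScale a x) y))
    (LAdd (LScale a (LLie z x)) (LLie z y))
| leq_liexx x : lterm_eq (LLie x x) LZero
| leq_jacobi x y z : lterm_eq
    (LAdd (LAdd (LLie x (LLie y z)) (LLie y (LLie z x))) (LLie z (LLie x y)))
    LZero.

HB.instance Definition _ := gen_eqMixin lterm.
HB.instance Definition _ := gen_choiceMixin lterm.

Definition lterm_eqb (x y : lterm) : bool := `[< lterm_eq x y >].

Lemma lterm_eqb_equiv : equiv_class_of lterm_eqb.
Proof.
split=> [x|x y|y x z].
- by apply/asboolP; apply: leq_refl.
- by apply/asboolP/asboolP => /leq_sym.
- move=> /asboolP xy /asboolP yz; apply/asboolP; exact: leq_trans xy yz.
Qed.
Canonical lterm_equiv := EquivRelPack lterm_eqb_equiv.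
Canonical lterm_encModRel := defaultEncModRel lterm_eqb.

Definition free_lie : Type := {eq_quot lterm_eqb}.
HB.instance Definition _ := Choice.on free_lie.

Definition fpi (t : lterm) : free_lie := \pi_{eq_quot lterm_eqb} t.
Definition frepr (q : free_lie) : lterm := repr (q : {eq_quot lterm_eqb}).

Lemma fpi_eq x y : lterm_eq x y -> fpi x = fpi y.
Proof. by move=> xy; apply/(eqmodP lterm_equiv)/asboolP. Qed.
Lemma frepr_pi x : lterm_eq (frepr (fpi x)) x.
Proof. apply/asboolP/(eqmodP lterm_equiv); exact: reprK. Qed.
Lemma freprK q : fpi (frepr q) = q. Proof. exact: reprK. Qed.

Definition free_var (x : X) : free_lie := fpi (LVar x).
Definition free_zero : free_lie := fpi LZero.
Definition free_opp (p : free_lie) := fpi (LOpp (frepr p)).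
Definition free_add (p q : free_lie) := fpi (LAdd (frepr p) (frepr q)).
Definition free_scale (a : K) (p : free_lie) := fpi (LScale a (frepr p)).
Definition free_bracket (p q : free_lie) := fpi (LLie (frepr p) (frepr q)).

Lemma fpiN x : free_opp (fpi x) = fpi (LOpp x).
Proof. by apply/fpi_eq/leq_opp/frepr_pi. Qed.
Lemma fpiD x y : free_add (fpi x) (fpi y) = fpi (LAdd x y).
Proof. by apply/fpi_eq/leq_add; apply/frepr_pi. Qed.
Lemma fpiZ a x : free_scale a (fpi x) = fpi (LScale a x).
Proof. by apply/fpi_eq/leq_scale/frepr_pi. Qed.
Lemma fpiL x y : free_bracket (fpi x) (fpi y) = fpi (LLie x y).
Proof. by apply/fpi_eq/leq_lie; apply/frepr_pi. Qed.

Lemma freeW (P : free_lie -> Prop) : (forall x, P (fpi x)) -> forall q, P q.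
Proof. by move=> Ppi q; rewrite -(freprK q). Qed.

Lemma free_addA : associative free_add.
Proof.
elim/freeW => x; elim/freeW => y; elim/freeW => z; rewrite !fpiD.
exact/fpi_eq/leq_addA.
Qed.
Lemma free_addC : commutative free_add.
Proof.
elim/freeW => x; elim/freeW => y; rewrite !fpiD; exact/fpi_eq/leq_addC.
Qed.
Lemma free_add0 : left_id free_zero free_add.
Proof. elim/freeW => x; rewrite fpiD; exact/fpi_eq/leq_add0. Qed.
Lemma free_addN : left_inverse free_zero free_opp free_add.
Proof. elim/freeW => x; rewrite fpiN fpiD; exact/fpi_eq/leq_addN. Qed.
HB.instance Definition _ := GRing.isZmodule.Build free_lie
  free_addA free_addC free_add0 free_addN.

Lemma free_scaleA a b q : free_scale a (free_scale b q) = free_scale (a * b) q.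
Proof. elim/freeW: q => x; rewrite !fpiZ; exact/fpi_eq/leq_scaleA. Qed.
Lemma free_scale1 : left_id 1 free_scale.
Proof. elim/freeW => x; rewrite fpiZ; exact/fpi_eq/leq_scale1. Qed.
Lemma free_scaleDr : right_distributive free_scale +%R.
Proof.
move=> a; elim/freeW => x; elim/freeW => y; rewrite -[RHS]/(free_add _ _).
by rewrite -[fpi x + _]/(free_add _ _) fpiD !fpiZ fpiD; apply/fpi_eq/leq_scaleDr.
Qed.
Lemma free_scaleDl q : {morph free_scale^~ q : a b / a + b}.
Proof.
elim/freeW: q => x a b; rewrite -[RHS]/(free_add _ _) !fpiZ fpiD.
exact/fpi_eq/leq_scaleDl.
Qed.
HB.instance Definition _ := GRing.Zmodule_isLmodule.Build K free_lie
  free_scaleA free_scale1 free_scaleDr free_scaleDl.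

Lemma fpi_linE a x y : a *: fpi x + fpi y = fpi (LAdd (LScale a x) y).
Proof. by rewrite -fpiD -fpiZ. Qed.

Lemma free_bracket_linearl q : linear (free_bracket^~ q).
Proof.
elim/freeW: q => z a; elim/freeW => x; elim/freeW => y /=.
by rewrite fpi_linE !fpiL fpi_linE; apply/fpi_eq/leq_lie_linearl.
Qed.
Lemma free_bracket_linearr p : linear (free_bracket p).
Proof.
elim/freeW: p => z a; elim/freeW => x; elim/freeW => y /=.
by rewrite fpi_linE !fpiL fpi_linE; apply/fpi_eq/leq_lie_linearr.
Qed.
Lemma free_bracketxx q : free_bracket q q = 0.
Proof. by elim/freeW: q => x; rewrite fpiL; apply/fpi_eq/leq_liexx. Qed.
Lemma free_bracket_jacobi p q r : free_bracket p (free_bracket q r)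
  + free_bracket q (free_bracket r p) + free_bracket r (free_bracket p q) = 0.
Proof.
elim/freeW: p => x; elim/freeW: q => y; elim/freeW: r => z.
rewrite -[_ + _ + _]/(free_add (free_add _ _) _) !fpiL !fpiD.
exact/fpi_eq/leq_jacobi.
Qed.
HB.instance Definition _ := Lmodule_isLieAlgebra.Build K free_lie
  free_bracket_linearl free_bracket_linearr free_bracketxx free_bracket_jacobi.

Section Lift.
Variables (L : lieAlgType K) (f : X -> L).

Fixpoint lterm_eval (t : lterm) : L :=
  match t with
  | LVar x => f x
  | LZero => 0
  | LOpp x => - lterm_eval x
  | LAdd x y => lterm_eval x + lterm_eval y
  | LScale a x => a *: lterm_eval x
  | LLie x y => lie (lterm_eval x) (lterm_eval y)
  end.

Lemma lterm_eval_eq x y : lterm_eq x y -> lterm_eval x = lterm_eval y.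
Proof.
elim=> {x y} /=; try by move=> *; congruence.
- by move=> *; apply: addrA.
- by move=> *; apply: addrC.
- by move=> *; apply: add0r.
- by move=> *; apply: addNr.
- by move=> *; apply: scalerA.
- by move=> *; apply: scale1r.
- by move=> *; apply: scalerDr.
- by move=> a b x; rewrite scalerDl.
- by move=> a x y z; rewrite lieDl lieZl.
- by move=> a x y z; rewrite lieDr lieZr.
- by move=> x; rewrite liexx.
- by move=> x y z; rewrite lie_jacobi.
Qed.

Definition free_lift (q : free_lie) : L := lterm_eval (frepr q).

Lemma free_lift_pi t : free_lift (fpi t) = lterm_eval t.
Proof. exact/lterm_eval_eq/frepr_pi. Qed.

Lemma free_lift_is_linear : linear free_lift.
Proof.
by move=> a; elim/freeW => x; elim/freeW => y; rewrite fpi_linE !free_lift_pi.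
Qed.
Lemma free_lift_is_lie : {morph free_lift : x y / lie x y >-> lie x y}.
Proof.
elim/freeW => x; elim/freeW => y.
by rewrite -[lie (fpi x) _]/(free_bracket _ _) fpiL !free_lift_pi.
Qed.
HB.instance Definition _ := GRing.isLinear.Build K free_lie L _ free_lift
  free_lift_is_linear.
HB.instance Definition _ := isLieMorphism.Build K free_lie L free_lift
  free_lift_is_lie.

Lemma free_liftE x : free_lift (free_var x) = f x.
Proof. exact: free_lift_pi. Qed.

End Lift.
End FreeLie.

Definition free_nilpotent (K : fieldType) (r c : nat) : lieAlgType K :=
  lie_quot (gamma (free_lie K 'I_r) c.+1).

(* Generated by the disjoint union of A and B, subject to the relations making
   the two maps A -> A * B and B -> A * B morphisms of Lie algebras. *)

Section FreeProduct.
Variables (K : fieldType) (A B : lieAlgType K).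

Inductive freeprod_rel : free_lie K (A + B) -> Prop :=
| freeprod_linl a x y : freeprod_rel
    (free_var K (inl (a *: x + y))
     - (a *: free_var K (inl x) + free_var K (inl y)))
| freeprod_liel x y : freeprod_rel
    (free_var K (inl (lie x y))
     - lie (free_var K (inl x)) (free_var K (inl y)))
| freeprod_linr a x y : freeprod_rel
    (free_var K (inr (a *: x + y))
     - (a *: free_var K (inr x) + free_var K (inr y)))
| freeprod_lier x y : freeprod_rel
    (free_var K (inr (lie x y))
     - lie (free_var K (inr x)) (free_var K (inr y))).

Definition freeprod : lieAlgType K := lie_quot (ideal_gen freeprod_rel).

Definition freeprod_inl (x : A) : freeprod := lie_pi _ (free_var K (inl x)).
Definition freeprod_inr (x : B) : freeprod := lie_pi _ (free_var K (inr x)).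

Lemma freeprod_relE s t : freeprod_rel (s - t) ->
  lie_pi (ideal_gen freeprod_rel) s = lie_pi _ t.
Proof. by move=> st; apply/eqP; rewrite lie_pi_eq mem_ideal_gen. Qed.

Lemma freeprod_inl_is_linear : linear freeprod_inl.
Proof. by move=> a x y; rewrite -linearP; apply/freeprod_relE; constructor. Qed.
HB.instance Definition _ := GRing.isLinear.Build K A freeprod _ freeprod_inl
  freeprod_inl_is_linear.
Lemma freeprod_inl_is_lie : {morph freeprod_inl : x y / lie x y >-> lie x y}.
Proof. by move=> x y; rewrite -lie_morph; apply/freeprod_relE; constructor. Qed.
HB.instance Definition _ := isLieMorphism.Build K A freeprod freeprod_inl
  freeprod_inl_is_lie.

Lemma freeprod_inr_is_linear : linear freeprod_inr.
Proof. by move=> a x y; rewrite -linearP; apply/freeprod_relE; constructor. Qed.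
HB.instance Definition _ := GRing.isLinear.Build K B freeprod _ freeprod_inr
  freeprod_inr_is_linear.
Lemma freeprod_inr_is_lie : {morph freeprod_inr : x y / lie x y >-> lie x y}.
Proof. by move=> x y; rewrite -lie_morph; apply/freeprod_relE; constructor. Qed.
HB.instance Definition _ := isLieMorphism.Build K B freeprod freeprod_inr
  freeprod_inr_is_lie.

Section Lift.
Variables (M : lieAlgType K) (f : lieHom A M) (g : lieHom B M).

Definition freeprod_var (u : A + B) : M :=
  match u with inl x => f x | inr y => g y end.

Lemma freeprod_lift_subproof :
  {subset ideal_gen freeprod_rel <= lie_ker (free_lift freeprod_var)}.
Proof.
apply: ideal_gen_sub => _ [a x y|x y|a x y|x y];
  rewrite unfold_in raddfB /= subr_eq0; apply/eqP.
- by rewrite linearP /= !free_liftE; apply: linearP.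
- by rewrite lie_morph /= !free_liftE /= lie_morph.
- by rewrite linearP /= !free_liftE; apply: linearP.
- by rewrite lie_morph /= !free_liftE /= lie_morph.
Qed.

Definition freeprod_lift : lieHom freeprod M :=
  quot_lift freeprod_lift_subproof.

Lemma freeprod_lift_inl x : freeprod_lift (freeprod_inl x) = f x.
Proof.
exact: etrans (quot_liftE freeprod_lift_subproof _) (free_liftE _ _).
Qed.
Lemma freeprod_lift_inr x : freeprod_lift (freeprod_inr x) = g x.
Proof.
exact: etrans (quot_liftE freeprod_lift_subproof _) (free_liftE _ _).
Qed.

End Lift.
End FreeProduct.

Section Chi.
Variables (K : fieldType) (g : lieAlgType K).

(* The copy of g in the second factor of the free product plays the role of
   the isomorphic copy of g, and freeprod_inr that of psi. *)
Inductive chi_rel : freeprod g g -> Prop :=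
| ChiRel (x : g) : chi_rel (lie (freeprod_inl g x) (freeprod_inr g x)).

Definition chi : lieAlgType K := lie_quot (ideal_gen chi_rel).

Definition chi_in (x : g) : chi := lie_pi _ (freeprod_inl g x).
Definition chi_psi (x : g) : chi := lie_pi _ (freeprod_inr g x).

Lemma idfun_is_lie : {morph (@idfun g) : x y / lie x y >-> lie x y}.
Proof. by []. Qed.
HB.instance Definition _ := isLieMorphism.Build K g g idfun idfun_is_lie.

Definition codiagonal : lieHom (freeprod g g) g := freeprod_lift idfun idfun.

Lemma chi_alpha_subproof : {subset ideal_gen chi_rel <= lie_ker codiagonal}.
Proof.
apply: ideal_gen_sub => _ [x].
by rewrite unfold_in lie_morph freeprod_lift_inl freeprod_lift_inr liexx.
Qed.

Definition chi_alpha : lieHom chi g := quot_lift chi_alpha_subproof.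

Lemma chi_alpha_in x : chi_alpha (chi_in x) = x.
Proof.
exact: etrans (quot_liftE chi_alpha_subproof _) (freeprod_lift_inl _ _ _).
Qed.
Lemma chi_alpha_psi x : chi_alpha (chi_psi x) = x.
Proof.
exact: etrans (quot_liftE chi_alpha_subproof _) (freeprod_lift_inr _ _ _).
Qed.

Definition chi_L : lieAlgType K := ideal_alg (lie_ker chi_alpha).

End Chi.

(* Main.v *)
Require Import Defs.
From HB Require Import structures.
From mathcomp Require Import all_boot all_order all_algebra.
From mathcomp Require Import boolp ring zify.

(** Write d x for the element x - x^psi of chi(g). Polarizing [x, x^psi] = 0
    yields 2 [x, d y] = d [x, y] + [d x, d y], so that in characteristic
    different from two the action of g on d g is determined by brackets of
    elements of d g (lie_hom_diff). The Jacobi identity for this action then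
    forces the triple relation [[d x, d y], d z] = d [[x, y], z]
    (hom_diff_triple), and L(g) is the subalgebra generated by d g
    (kernel_gen).

    There are no other relations. Let U be the Lie algebra generated by a linear
    copy d g of g subject to the triple relations, that is, the universal
    algebra on g as a Lie triple system. The formula d x |-> d [y, x]
    defines derivations of U, and y in g acts on U by half the sum of this
    derivation and of ad (d y). Mapping x to (0, x) and x^psi to (- d x, x)
    defines a morphism from chi(g) to the semidirect product of U and g
    (chi_env), and shows that L(g) has the universal property of U: maps from
    g that satisfy the triple relation extend to L(g) (kernel_lift).

    When g is the free nilpotent algebra h of rank m and class 3, with
    N = m (m - 1) / 2, decompose h as V1 + V2 + V3 by degree. The model of L(h)
    is the direct sum of n_(m,4), of n_(N,2) and of a central copy of the tensor
    product of V1 and V2, in which the linear parts of elements of the first two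
    summands have their tensor product as bracket. From h to the model there is
    a map satisfying the triple relation: it places V1 and V3 in n_(m,4), as the
    odd part for the sign change of the generators, and identifies V2 with the
    span of the generators of n_(N,2) (to_model_triple). This gives a morphism
    from L(h) to the model. In the other direction, the universal properties of
    the free nilpotent algebras apply because the fifth term of the lower
    central series of chi(h) is zero (chi_gamma5) and because the brackets of
    d V1 and d V2 are central, as the triple relation moves them to degree four
    in h (central_bracket). Comparing generators shows that the two morphisms
    are inverse to each other. The central ideal is the tensor product.

    Finally chi(h) has class exactly four because n_(m,4) embeds in L(h) and
    contains the nonzero element [x, [x, [x, y]]] for distinct generators x and
    y (free_nilpotent_engel). *)

Set Implicit Arguments.
Unset Strict Implicit.
Unset Printing Implicit Defensive.

Import GRing.Theory.
Local Open Scope ring_scope.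

(** * Identities in modules *)

Section SquareZero.
Variables (K : fieldType) (V : lmodType K).

(** The trivial square-zero extension of K by V, a commutative ring that
    contains V as an additive subgroup on which K acts by multiplication: an
    identity of the module V becomes an identity that ring decides. *)
Definition sqzero : Type := (K * V)%type.
HB.instance Definition _ := GRing.Zmodule.on sqzero.

Definition sqzero_mul (x y : sqzero) : sqzero :=
  (x.1 * y.1, x.1 *: y.2 + y.1 *: x.2).

Lemma sqzero_mulA : associative sqzero_mul.
Proof.
move=> x y z; congr pair => /=; first exact: mulrA.
by rewrite !scalerDr !scalerA addrA [z.1 * _]mulrC [z.1 * _]mulrC.
Qed.
Lemma sqzero_mulC : commutative sqzero_mul.
Proof. by move=> x y; congr pair => /=; rewrite (mulrC, addrC). Qed.
Lemma sqzero_mul1 : left_id (1, 0) sqzero_mul.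
Proof.
by case=> a v; congr pair => /=; rewrite ?mul1r // scale1r scaler0 addr0.
Qed.
Lemma sqzero_mulD : left_distributive sqzero_mul +%R.
Proof.
move=> x y z; congr pair => /=; first exact: mulrDl.
by rewrite scalerDl scalerDr addrACA.
Qed.
HB.instance Definition _ := GRing.Zmodule_isComPzRing.Build sqzero
  sqzero_mulA sqzero_mulC sqzero_mul1 sqzero_mulD.

Definition sqzero_in (v : V) : sqzero := (0, v).
Definition sqzero_scalar (a : K) : sqzero := (a, 0).

Lemma sqzero_in_is_additive : zmod_morphism sqzero_in.
Proof. by move=> u v; congr pair; rewrite /= subr0. Qed.
HB.instance Definition _ :=
  GRing.isZmodMorphism.Build V sqzero sqzero_in sqzero_in_is_additive.

Lemma sqzero_scalar_is_additive : zmod_morphism sqzero_scalar.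
Proof. by move=> u v; congr pair; rewrite /= subr0. Qed.
HB.instance Definition _ :=
  GRing.isZmodMorphism.Build K sqzero sqzero_scalar sqzero_scalar_is_additive.
Lemma sqzero_scalar_is_monoid : monoid_morphism sqzero_scalar.
Proof. by split=> // a b; congr pair; rewrite /= !scaler0 addr0. Qed.
HB.instance Definition _ :=
  GRing.isMonoidMorphism.Build K sqzero sqzero_scalar sqzero_scalar_is_monoid.

Lemma sqzero_in_inj : injective sqzero_in. Proof. by move=> u v []. Qed.
Lemma sqzero_inD u v : sqzero_in (u + v) = sqzero_in u + sqzero_in v.
Proof. exact: raddfD. Qed.
Lemma sqzero_inN v : sqzero_in (- v) = - sqzero_in v.
Proof. exact: raddfN. Qed.
Lemma sqzero_inZ a v : sqzero_in (a *: v) = sqzero_scalar a * sqzero_in v.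
Proof. by congr pair; rewrite /= ?mulr0 // scale0r addr0. Qed.

End SquareZero.

Ltac lmod :=
  apply: sqzero_in_inj; rewrite ?(sqzero_inD, sqzero_inN, sqzero_inZ); ring.

(** * Subalgebras, lower central series and morphisms *)

Section Generation.
Variables (K : fieldType) (L : lieAlgType K).
Implicit Types (S P : L -> Prop) (x y z u : L).

Definition subspace P : Prop :=
  P 0 /\ forall a u v, P u -> P v -> P (a *: u + v).

Definition subalgebra P : Prop :=
  subspace P /\ forall u v, P u -> P v -> P (lie u v).

(** The closures are intersections, so that an element of one of them is
    eliminated by applying its membership proof to a predicate. *)
Definition lspan S x : Prop :=
  forall P, subspace P -> (forall u, S u -> P u) -> P x.

Definition lie_gen S x : Prop :=
  forall P, subalgebra P -> (forall u, S u -> P u) -> P x.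

Lemma subspaceD P x y : subspace P -> P x -> P y -> P (x + y).
Proof. by move=> [_ PD] Px Py; rewrite -[x]scale1r; apply: PD. Qed.

Lemma subspaceZ P a x : subspace P -> P x -> P (a *: x).
Proof. by move=> [P0 PD] Px; rewrite -[_ *: _]addr0; apply: PD. Qed.

Lemma subspaceN P x : subspace P -> P x -> P (- x).
Proof. by move=> sP Px; rewrite -scaleN1r; apply: subspaceZ. Qed.

Lemma subspaceB P x y : subspace P -> P x -> P y -> P (x - y).
Proof. by move=> sP Px Py; apply: subspaceD => //; apply: subspaceN. Qed.

Lemma subspace_ideal (I : lieIdeal L) : subspace (fun x => x \in I).
Proof.
by split=> [|a u v uI vI]; [apply: rpred0 | rewrite rpredD ?rpredZ].
Qed.

Lemma subalgebra_ideal (I : lieIdeal L) : subalgebra (fun x => x \in I).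
Proof.
by split=> [|u v _ vI]; [apply: subspace_ideal | apply: lie_idealr].
Qed.

Lemma subspace_lspan S : subspace (lspan S).
Proof.
split=> [P [] //|a u v Su Sv P sP SP].
by case: (sP) => _; apply; [apply: Su | apply: Sv].
Qed.

Lemma lspan_in S x : S x -> lspan S x.
Proof. by move=> Sx P _; apply. Qed.

Lemma subalgebra_lie_gen S : subalgebra (lie_gen S).
Proof.
split; first split=> [P [[]] //|a u v Su Sv P sP SP].
  by case: (sP) => -[_ + _]; apply; [apply: Su | apply: Sv].
move=> u v Su Sv P sP SP.
by case: (sP) => _; apply; [apply: Su | apply: Sv].
Qed.

Lemma lie_gen_in S x : S x -> lie_gen S x.
Proof. by move=> Sx P _; apply. Qed.

Lemma lie_deriv x y z : lie x (lie y z) = lie (lie x y) z + lie y (lie x z).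
Proof.
have := lie_jacobi x y z; rewrite [lie z x]lieC [lie z _]lieC lieNr.
move=> /eqP; rewrite subr_eq0 => /eqP <-.
by rewrite subrK.
Qed.

Lemma lie_lie x y z : lie (lie x y) z = lie x (lie y z) - lie y (lie x z).
Proof. by rewrite lie_deriv addrK. Qed.

(** By the Jacobi identity, what raises a decreasing filtration by one step
    is a subalgebra; it suffices to test generators. *)
Lemma lie_gen_raises S (W : nat -> L -> Prop) :
    (forall k, subspace (W k)) -> (forall k x, W k.+1 x -> W k x) ->
    (forall k x y, S x -> W k y -> W k.+1 (lie x y)) ->
  forall x, lie_gen S x -> forall k y, W k y -> W k.+1 (lie x y).
Proof.
move=> sW decW SW x /(_ (fun x => forall k y, W k y -> W k.+1 (lie x y))).
apply; last by move=> u Su k y; apply: SW.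
split; first split.
- by move=> k y _; rewrite lie0x; case: (sW k.+1).
- move=> a u v IHu IHv k y Wy; rewrite lieDl lieZl.
  by case: (sW k.+1) => _; apply; [apply: IHu | apply: IHv].
- move=> u v IHu IHv k y Wy; rewrite lie_lie.
  by apply: subspaceB => //; apply: decW; [apply/IHu/IHv | apply/IHv/IHu].
Qed.

Lemma subspace_lier P x : subspace P -> subspace (fun y => P (lie x y)).
Proof.
move=> [P0 PD]; split=> [|a u v Pu Pv]; first by rewrite liex0.
by rewrite lieDr lieZr; apply: PD.
Qed.

Lemma subspace_liel P x : subspace P -> subspace (fun y => P (lie y x)).
Proof.
move=> [P0 PD]; split=> [|a u v Pu Pv]; first by rewrite lie0x.
by rewrite lieDl lieZl; apply: PD.
Qed.

Lemma subspace_all (T : Type) (Q : T -> L -> Prop) :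
  (forall t, subspace (Q t)) -> subspace (fun x => forall t, Q t x).
Proof.
move=> sQ; split=> [t|a u v Qu Qv t]; first by case: (sQ t).
by case: (sQ t) => _; apply.
Qed.

Lemma lieMnr x y n : lie x (y *+ n) = lie x y *+ n.
Proof. by elim: n => [|n IHn]; rewrite ?liex0 // !mulrS lieDr IHn. Qed.

Lemma lieMnl x y n : lie (y *+ n) x = lie y x *+ n.
Proof. by rewrite lieC lieMnr -mulNrn -lieC. Qed.

Lemma subalgebra_centraliser x : subalgebra (fun y => lie y x = 0).
Proof.
split=> [|u v ux vx]; last by rewrite lie_lie ux vx !liex0 subr0.
split=> [|a u v ux vx]; first exact: lie0x.
by rewrite lieDl lieZl ux vx scaler0 addr0.
Qed.

End Generation.

Section LowerCentralSeries.
Variables (K : fieldType) (L : lieAlgType K).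
Implicit Types (x y z : L).

Lemma gamma1 x : x \in gamma L 1. Proof. by []. Qed.

Lemma gammaS k x y : y \in gamma L k.+1 -> lie x y \in gamma L k.+2.
Proof. by move=> yG; apply/asboolP => W; apply. Qed.

Lemma gamma2 x y : lie x y \in gamma L 2.
Proof. exact: gammaS. Qed.

Section AsSubmod.
Variables (P : L -> Prop) (sP : subspace P).

Definition submod_pred of subspace P : {pred L} := fun x => `[< P x >].

Lemma submod_pred_closed : submod_closed (submod_pred sP).
Proof.
split=> [|a u v /asboolP Pu /asboolP Pv]; apply/asboolP; first by case: sP.
by case: sP => _; apply.
Qed.
HB.instance Definition _ := GRing.isSubmodClosed.Build K L (submod_pred sP)
  submod_pred_closed.

Lemma gamma_elim k : (forall x y, y \in gamma L k.+1 -> P (lie x y)) ->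
  forall x, x \in gamma L k.+2 -> P x.
Proof.
move=> Pgen x /asboolP/(_ (submod_pred sP)) Gx; apply/asboolP/Gx => y z zG.
exact/asboolP/Pgen.
Qed.

End AsSubmod.

Lemma gamma_ind (W : nat -> L -> Prop) :
    (forall k, subspace (W k)) -> (forall x, W 1%N x) ->
    (forall k x y, W k.+1 y -> W k.+2 (lie x y)) ->
  forall k x, x \in gamma L k.+1 -> W k.+1 x.
Proof.
move=> sW W1 WS; elim=> [//|k IHk].
by apply: (gamma_elim (sW _)) => x y /IHk; apply: WS.
Qed.

Lemma gamma_dec k : {subset gamma L k.+2 <= gamma L k.+1}.
Proof.
apply: (gamma_elim (subspace_ideal _)) => x y; exact: lie_idealr.
Qed.

Lemma gamma_dec0 k x : x \in gamma L k.+1 -> x \in gamma L k.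
Proof. by case: k => [//|k]; apply: gamma_dec. Qed.

Lemma gammaS0 k x y : y \in gamma L k -> lie x y \in gamma L k.+1.
Proof. by case: k => [//|k]; apply: gammaS. Qed.

Lemma gammaB k x y :
  x \in gamma L k -> y \in gamma L k -> x - y \in gamma L k.
Proof. exact: rpredB. Qed.

Lemma gamma_leq i j : (i <= j)%N -> {subset gamma L j.+1 <= gamma L i.+1}.
Proof.
move=> /subnK <-; elim: (j - i)%N => // k IHk x.
by rewrite addSn => /gamma_dec/IHk.
Qed.

Lemma gammaM i j x y : x \in gamma L i.+1 -> y \in gamma L j.+1 ->
  lie x y \in gamma L (i + j).+2.
Proof.
move=> xG; move: i x xG j y.
apply: (@gamma_ind (fun i x => forall j y, y \in gamma L j.+1 ->
  lie x y \in gamma L (i.-1 + j).+2)).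
- move=> k; do 2![apply: subspace_all => ?].
  split=> [|a u v IHu IHv yG]; first by rewrite lie0x rpred0.
  by rewrite lieDl lieZl rpredD ?rpredZ ?IHu ?IHv.
- by move=> x j y; apply: gammaS.
- move=> k u x IHx j y yG; rewrite lie_lie rpredB //; first exact/gammaS/IHx.
  by rewrite [(k.+2.-1 + j)%N]addSnnS; apply/IHx/gammaS.
Qed.

End LowerCentralSeries.

Section Morphisms.
Variables (K : fieldType) (A B : lieAlgType K).

Definition lie_hom_of (f : A -> B) (lf : linear f)
    (mf : {morph f : x y / lie x y >-> lie x y}) : lieHom A B :=
  HB.pack f (GRing.isLinear.Build K A B *:%R f lf)
    (isLieMorphism.Build K A B f mf).

Lemma gamma_morph (f : lieHom A B) k x :
  x \in gamma A k.+1 -> f x \in gamma B k.+1.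
Proof.
move: k x; apply: (@gamma_ind _ _ (fun k x => f x \in gamma B k)) => //.
- by move=> k; split=> [|a u v]; [rewrite raddf0 rpred0 | rewrite linearP /=;
    move=> uG vG; rewrite rpredD ?rpredZ].
- by move=> k x y; rewrite lie_morph; apply: gammaS.
Qed.

Lemma subalgebra_preim (f : lieHom A B) (P : B -> Prop) :
  subalgebra P -> subalgebra (fun x => P (f x)).
Proof.
move=> [[P0 PD] PL]; split; first split; first by rewrite raddf0.
- by move=> a u v Pu Pv; rewrite linearP; apply: PD.
- by move=> u v Pu Pv; rewrite lie_morph; apply: PL.
Qed.

Lemma subalgebra_image (f : lieHom A B) : subalgebra (fun y =>
  exists x, y = f x).
Proof.
split; first split; first by exists 0; rewrite raddf0.
- by move=> a _ _ [u ->] [v ->]; exists (a *: u + v); rewrite linearP.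
- by move=> _ _ [u ->] [v ->]; exists (lie u v); rewrite lie_morph.
Qed.

Lemma subalgebra_equalizer (f g : lieHom A B) : subalgebra (fun x => f x = g x).
Proof.
split; first split; first by rewrite !raddf0.
- by move=> a u v fgu fgv; rewrite !linearP /= fgu fgv.
- by move=> u v fgu fgv; rewrite !lie_morph fgu fgv.
Qed.

Lemma lie_ker_iso (f : lieHom A B) (s : B -> A) :
  cancel s f -> lie_isomorphic (lie_quot (lie_ker f)) B.
Proof.
move=> sK; pose sub x (xI : x \in lie_ker f) := xI.
have liftE x : quot_lift sub (lie_pi _ x) = f x by apply: quot_liftE.
exists (quot_lift sub), (fun b => lie_pi _ (s b)) => [|b]; last first.
  by rewrite /= liftE.
elim/quotW => a; rewrite /= liftE; apply/eqP; rewrite lie_pi_eq.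
by rewrite unfold_in raddfB /= sK subrr.
Qed.

End Morphisms.

Section Composition.
Variables (K : fieldType) (A B C : lieAlgType K).
Variables (f : lieHom B C) (g : lieHom A B).

Lemma lie_comp_linear : linear (f \o g).
Proof. by move=> a u v; rewrite /= !linearP. Qed.

Lemma lie_comp_lie : {morph f \o g : x y / lie x y >-> lie x y}.
Proof. by move=> x y; rewrite /= !lie_morph. Qed.

Definition lie_comp : lieHom A C := lie_hom_of lie_comp_linear lie_comp_lie.

End Composition.

(** * Generators of free, quotient and free nilpotent algebras *)

Section FreeGeneration.
Variables (K : fieldType).

Lemma free_lie_gen (X : Type) (u : free_lie K X) :
  lie_gen (fun v => exists x, v = free_var K x) u.
Proof.
move=> P [sP PL] PX; elim/freeW: u.
elim=> [x||t Pt|t Pt s Ps|a t Pt|t Pt s Ps].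
- by apply: PX; exists x.
- by case: sP.
- by rewrite -fpiN; apply: (subspaceN sP).
- by rewrite -fpiD; apply: (subspaceD sP).
- by rewrite -fpiZ; apply: (subspaceZ a sP).
- by rewrite -fpiL; apply: PL.
Qed.

Lemma quot_gen (L : lieAlgType K) (I : lieIdeal L) (S : L -> Prop) :
  (forall x, lie_gen S x) ->
  forall q : lie_quot I, lie_gen (fun p => exists2 x, S x & p = lie_pi I x) q.
Proof.
move=> genS; elim/quotW => x P sP PS.
apply: (genS x (fun x => P (lie_pi I x))).
  exact: (@subalgebra_preim _ _ _ (lie_pi I) P).
by move=> u Su; apply: PS; exists u.
Qed.

Lemma gamma_quot (L : lieAlgType K) (I : lieIdeal L) k (q : lie_quot I) :
  q \in gamma (lie_quot I) k.+1 ->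
    exists2 x, x \in gamma L k.+1 & q = lie_pi I x.
Proof.
move: k q.
apply: (@gamma_ind _ _
  (fun k q => exists2 x, x \in gamma L k & q = lie_pi I x)) =>
    [k|q|k p _ [x xG ->]].
- split=> [|a _ _ [x xG ->] [y yG ->]]; first by exists 0;
  rewrite ?rpred0 ?raddf0.
  by exists (a *: x + y); rewrite ?linearP // rpredD ?rpredZ.
- by elim/quotW: q => x; exists x.
- by elim/quotW: p => y; exists (lie y x); rewrite ?lie_morph ?gammaS.
Qed.

Variables (r c : nat).

Definition nvar (i : 'I_r) : free_nilpotent K r c := lie_pi _ (free_var K i).

Lemma nilpotent_gen (q : free_nilpotent K r c) :
  lie_gen (fun p => exists i, p = nvar i) q.
Proof.
move=> P sP PS; apply: (quot_gen (@free_lie_gen _)) => // _ [_ [i ->] ->].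
by apply: PS; exists i.
Qed.

Lemma free_nilpotent_gamma x : x \in gamma (free_nilpotent K r c) c.+1 -> x = 0.
Proof.
by case/gamma_quot => y yG ->; apply/eqP; rewrite -(raddf0 (lie_pi _))
  lie_pi_eq subr0.
Qed.

Section Lift.
Variables (L : lieAlgType K) (f : 'I_r -> L).
Hypothesis fG : forall u, u \in gamma (free_lie K 'I_r) c.+1 ->
  free_lift f u = 0.

Lemma nlift_subproof :
  {subset gamma (free_lie K 'I_r) c.+1 <= lie_ker (free_lift f)}.
Proof. by move=> u /fG fu0; apply/eqP. Qed.

Definition nlift : lieHom (free_nilpotent K r c) L := quot_lift nlift_subproof.

Lemma nliftE i : nlift (nvar i) = f i.
Proof. exact: etrans (quot_liftE nlift_subproof _) (free_liftE _ _). Qed.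

End Lift.
End FreeGeneration.

(** * Semidirect products *)

Section Abelian.
Variables (K : fieldType) (V : lmodType K).

Definition abel : Type := V.
HB.instance Definition _ := GRing.Lmodule.on abel.

Definition abel_lie (x y : abel) : abel := 0.

Lemma abel_lie_linear x : linear (abel_lie x).
Proof. by move=> a u v; rewrite /abel_lie scaler0 addr0. Qed.
Lemma abel_lie_jacobi x y z : abel_lie x (abel_lie y z)
  + abel_lie y (abel_lie z x) + abel_lie z (abel_lie x y) = 0.
Proof. by rewrite /abel_lie !addr0. Qed.
HB.instance Definition _ := Lmodule_isLieAlgebra.Build K abel
  abel_lie_linear abel_lie_linear (fun=> erefl) abel_lie_jacobi.

Lemma abelE (x y : abel) : lie x y = 0. Proof. by []. Qed.

End Abelian.

Record lie_action (K : fieldType) (A B : lieAlgType K) := LieAction {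
  act :> A -> B -> B;
  act_linearl : forall b, linear (act^~ b);
  act_linearr : forall a, linear (act a);
  act_deriv : forall a b c, act a (lie b c) = lie (act a b) c + lie b (act a c);
  act_lie : forall a a' b, act (lie a a') b =
    act a (act a' b) - act a' (act a b)
}.

Section Semidirect.
Variables (K : fieldType) (A B : lieAlgType K) (f : lie_action A B).

Lemma act0l b : f 0 b = 0.
Proof.
by have := act_linearl f b 1 0 0; rewrite !scale1r addr0 => /eqP;
  rewrite eq_sym -subr_eq0 addrK => /eqP.
Qed.
Lemma actDl a a' b : f (a + a') b = f a b + f a' b.
Proof. by have := act_linearl f b 1 a a'; rewrite !scale1r. Qed.
Lemma actZl k a b : f (k *: a) b = k *: f a b.
Proof. by have := act_linearl f b k a 0; rewrite /= act0l !addr0. Qed.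
Lemma act0r a : f a 0 = 0.
Proof.
by have := act_linearr f a 1 0 0; rewrite !scale1r addr0 => /eqP;
  rewrite eq_sym -subr_eq0 addrK => /eqP.
Qed.
Lemma actDr a b b' : f a (b + b') = f a b + f a b'.
Proof. by have := act_linearr f a 1 b b'; rewrite !scale1r. Qed.
Lemma actZr k a b : f a (k *: b) = k *: f a b.
Proof. by have := act_linearr f a k b 0; rewrite /= act0r !addr0. Qed.
Lemma actNr a b : f a (- b) = - f a b.
Proof. by rewrite -scaleN1r actZr scaleN1r. Qed.

Definition sdprod of lie_action A B : Type := (A * B)%type.
HB.instance Definition _ := GRing.Lmodule.on (sdprod f).

Definition sd_lie (x y : (sdprod f)) : (sdprod f) :=
  (lie x.1 y.1, f x.1 y.2 - f y.1 x.2 + lie x.2 y.2).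

Lemma sd_lie_linearl y : linear (sd_lie^~ y).
Proof.
move=> a u v; congr pair => /=; first by rewrite lieDl lieZl.
rewrite lieDl lieZl actDl actZl actDr actZr; lmod.
Qed.
Lemma sd_lie_linearr x : linear (sd_lie x).
Proof.
move=> a u v; congr pair => /=; first by rewrite lieDr lieZr.
rewrite lieDr lieZr actDl actZl actDr actZr; lmod.
Qed.
Lemma sd_liexx x : sd_lie x x = 0.
Proof. by congr pair; rewrite /= liexx // subrr addr0. Qed.
Lemma sd_lie_jacobi x y z : sd_lie x (sd_lie y z)
  + sd_lie y (sd_lie z x) + sd_lie z (sd_lie x y) = 0.
Proof.
congr pair => /=; first exact: lie_jacobi.
have J := lie_jacobi x.2 y.2 z.2.
move/eqP: J; rewrite -addrA addr_eq0 => /eqP J.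
rewrite !(lieDr, lieNr, actDr, actNr, act_lie, act_deriv) J.
rewrite [lie (f x.1 y.2) _]lieC [lie (f y.1 z.2) _]lieC [lie (f z.1 x.2) _]lieC.
lmod.
Qed.
HB.instance Definition _ := Lmodule_isLieAlgebra.Build K (sdprod f)
  sd_lie_linearl sd_lie_linearr sd_liexx sd_lie_jacobi.

Lemma sdlieE (x y : (sdprod f)) :
  lie x y = (lie x.1 y.1, f x.1 y.2 - f y.1 x.2 + lie x.2 y.2).
Proof. by []. Qed.

Definition sd_inl_fun (a : A) : (sdprod f) := (a, 0).
Lemma sd_inl_linear : linear sd_inl_fun.
Proof. by move=> a u v; congr pair; rewrite /= scaler0 addr0. Qed.
Lemma sd_inl_lie : {morph sd_inl_fun : x y / lie x y >-> lie x y}.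
Proof.
by move=> x y; congr pair; rewrite /= !act0r subrr liexx addr0.
Qed.
Definition sd_inl : lieHom A (sdprod f) := lie_hom_of sd_inl_linear sd_inl_lie.

Section Lift.
Variables (M : lieAlgType K) (p : lieHom A M) (q : lieHom B M).
Hypothesis pq : forall a b, q (f a b) = lie (p a) (q b).

Definition sd_lift_fun (x : (sdprod f)) : M := p x.1 + q x.2.
Lemma sd_lift_linear : linear sd_lift_fun.
Proof. by move=> a u v; rewrite /sd_lift_fun /= !linearP /=; lmod. Qed.
Lemma sd_lift_lie : {morph sd_lift_fun : x y / lie x y >-> lie x y}.
Proof.
move=> x y;
  rewrite /sd_lift_fun /= raddfD raddfB /= !lie_morph !pq !lieDl !lieDr.
rewrite [lie (q x.2) (p y.1)]lieC; lmod.
Qed.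
Definition sd_lift : lieHom (sdprod f) M := lie_hom_of sd_lift_linear
  sd_lift_lie.

End Lift.
End Semidirect.

(** Square-zero extension of U by its adjoint module: a morphism to it of the
    form u |-> (u, D u) is the same thing as a derivation D of U. *)
Section Adjoint.
Variables (K : fieldType) (U : lieAlgType K).

Definition adj_act (u : U) (v : abel U) : abel U := lie u (v : U).

Lemma adj_act_deriv u (v w : abel U) :
  adj_act u (lie v w) = lie (adj_act u v) w + lie v (adj_act u w).
Proof. by rewrite !abelE addr0; exact: (@liex0 K U u). Qed.

Definition adjoint : lie_action U (abel U) :=
  @LieAction K U (abel U) adj_act
    (fun v => lie_linearl (v : U)) (fun u => lie_linearr u) adj_act_deriv
    (fun u v w => lie_lie u v w).

End Adjoint.

(** * Weak commutativity in characteristic different from two *)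

Section WeaklyCommuting.
Variables (K : fieldType) (g C : lieAlgType K) (i psi : lieHom g C).
Hypothesis i_psi : forall x, lie (i x) (psi x) = 0.
Implicit Types (x y z : g) (u v : C).

Definition hom_diff x : C := i x - psi x.
Local Notation d := hom_diff.

Lemma hom_diff_linear : linear d.
Proof. by move=> a x y; rewrite /d (linearP i) (linearP psi) /=; lmod. Qed.
HB.instance Definition _ := GRing.isLinear.Build K g C _ d hom_diff_linear.

Lemma lie_hom_swap x y : lie (psi x) (i y) = lie (i x) (psi y).
Proof.
have := i_psi (x + y); rewrite !raddfD /= lieDl !lieDr !i_psi.
rewrite add0r addr0 => /eqP; rewrite addr_eq0 => /eqP ->.
exact: lieC.
Qed.

Lemma lie_hom_diff x y : lie (i x) (d y) *+ 2 = d (lie x y) + lie (d x) (d y).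
Proof.
by rewrite {3}/d /d !lie_morph !(lieDl, lieDr, lieNl, lieNr) lie_hom_swap; lmod.
Qed.

(** The bracket of g, seen through the difference d of the two morphisms,
    becomes a triple bracket in C: this is forced by the Jacobi identity for
    two elements i x, i y acting on d z, once these actions are rewritten by
    means of the previous lemma. *)
Lemma hom_diff_triple x y z :
  lie (lie (d x) (d y)) (d z) = d (lie (lie x y) z).
Proof.
have E a b : lie (i a) (lie (i b) (d z)) *+ 4 =
    d (lie a (lie b z)) + lie (d a) (d (lie b z)) + lie (d (lie a b)) (d z)
    + lie (lie (d a) (d b)) (d z) + lie (d b) (d (lie a z))
    + lie (d b) (lie (d a) (d z)).
  rewrite (mulrnA _ 2 2) -lieMnr lie_hom_diff lieDr mulrnDl lie_hom_diff.
  rewrite (lie_deriv (i a)) mulrnDl -(lieMnr (d b))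
    -(lieMnl _ (lie (i a) (d b))).
  by rewrite !lie_hom_diff lieDl lieDr; lmod.
have := congr1 (fun u => u *+ 4) (lie_lie (i x) (i y) (d z)).
rewrite -lie_morph mulrnBl !E (mulrnA _ 2 2) lie_hom_diff mulrnDl.
rewrite [lie y x]lieC raddfN lieNl [lie (d y) (d x)]lieC lieNl.
(* J says that the difference of the two sides of the goal is zero. *)
move=> /eqP; rewrite -subr_eq0 => /eqP J.
rewrite -[RHS]subr0 -J /= !(lie_lie x y z) !(lie_lie (d x) (d y) (d z))
  !raddfB /=.
lmod.
Qed.

Hypothesis two_neq0 : (2 : K) != 0.

Lemma lie_hom_diff_half x y :
  lie (i x) (d y) = 2^-1 *: (d (lie x y) + lie (d x) (d y)).
Proof. by rewrite -lie_hom_diff -scaler_nat scalerA mulVf ?scale1r. Qed.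

Local Notation D := (fun u => exists x, u = d x).

(** By the previous lemma, the subalgebra generated by the differences is
    stable under the action of the image of i, so that together they span a
    subalgebra, which contains the images of both morphisms. *)
Lemma hom_diff_gen :
    (forall u, lie_gen (fun v => exists x, v = i x \/ v = psi x) u) ->
  forall u, exists x v, lie_gen D v /\ u = i x + v.
Proof.
move=> gen; have sJ := subalgebra_lie_gen D; set J := lie_gen D in sJ *.
have [spJ lieJ] := sJ.
have Jd x : J (d x) by apply: lie_gen_in; exists x.
have Ji x v : J v -> J (lie (i x) v).
  move=> /(_ (fun v => J v /\ J (lie (i x) v))) IH; apply IH.
    split; first split.
    - by rewrite liex0; split; case: spJ.
    - move=> a u w [Ju Jiu] [Jw Jiw]; rewrite lieDr lieZr.
      by case: spJ => _ JD; split; apply: JD.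
    - move=> u w [Ju Jiu] [Jw Jiw]; split; first exact: lieJ.
      by rewrite lie_deriv; apply: (subspaceD spJ); apply: lieJ.
  move=> _ [y ->]; split=> //; rewrite lie_hom_diff_half.
  by apply: (subspaceZ _ spJ); apply: (subspaceD spJ) => //; apply: lieJ.
move=> u; apply: (gen u (fun u => exists x v, J v /\ u = i x + v)).
  split; first split.
  - by exists 0, 0; rewrite raddf0 addr0; split=> //; case: spJ.
  - move=> a _ _ [x [v [Jv ->]]] [y [w [Jw ->]]].
    exists (a *: x + y), (a *: v + w); split; first by case: spJ => _; apply.
    by rewrite linearP /=; lmod.
  - move=> _ _ [x [v [Jv ->]]] [y [w [Jw ->]]].
    exists (lie x y), (lie (i x) w - lie (i y) v + lie v w); split.
      apply: (subspaceD spJ); last exact: lieJ.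
      by apply: (subspaceB spJ); apply: Ji.
    rewrite lieDl !lieDr lie_morph [lie (i y) v]lieC; lmod.
move=> _ [x [->|->]]; [exists x, 0 | exists x, (- d x)].
  by rewrite addr0; split=> //; case: spJ.
by split; [apply: (subspaceN spJ) | rewrite /d; lmod].
Qed.

(** In the last case d x and d y have degrees a.+1 and b.+1. *)
Inductive diff_layer k : C -> Prop :=
| layer_hom x of x \in gamma g k : diff_layer k (i x)
| layer_diff x of x \in gamma g k : diff_layer k (d x)
| layer_lie a b x y of x \in gamma g a.+1 & y \in gamma g b.+1
    & (k <= (a + b).+2)%N : diff_layer k (lie (d x) (d y)).

(** The lower central series of C is controlled by that of g: the filtration
    by the spans of the layers is raised by i x and by d x, hence by everything
    that they generate. *)
Lemma gamma_diff :
    (forall u, lie_gen (fun v => exists x, v = i x \/ v = psi x) u) ->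
  forall k u, u \in gamma C k.+1 -> lspan (diff_layer k.+1) u.
Proof.
move=> gen; pose W k := lspan (diff_layer k).
have sW k : subspace (W k) by apply: subspace_lspan.
have Wgen k u (P : C -> Prop) : W k u -> subspace P ->
  (forall v, diff_layer k v -> P v) -> P u by move=> Wu sP PS; apply: Wu.
have Win k u : diff_layer k u -> W k u by apply: lspan_in.
have Whom k x : x \in gamma g k -> W k (i x).
  by move=> xG; apply: Win; apply: layer_hom.
have Wdiff k x : x \in gamma g k -> W k (d x).
  by move=> xG; apply: Win; apply: layer_diff.
have Wlie k a b x y : x \in gamma g a.+1 -> y \in gamma g b.+1 ->
    (k <= (a + b).+2)%N -> W k (lie (d x) (d y)).
  by move=> xG yG kab; apply: Win; apply: layer_lie xG yG kab.
have decW k u : W k.+1 u -> W k u.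
  move=> /Wgen; apply=> // _ [x xG|x xG|a b x y xG yG kab].
  - exact: Whom (gamma_dec0 xG).
  - exact: Wdiff (gamma_dec0 xG).
  - exact: Wlie xG yG (ltnW kab).
have Wtriple k a b x y : x \in gamma g a.+1 -> y \in gamma g b.+1 ->
    (k <= (a + b).+2)%N -> W k (d (lie x y)).
  move=> xG yG kab; apply: Wdiff; case: k kab => // k kab.
  exact: gamma_leq (gammaM xG yG).
have Wdd k x y : y \in gamma g k -> W k.+1 (lie (d x) (d y)).
  case: k => [|k] yG; first exact: Wlie (gamma1 x) (gamma1 y) _.
  exact: Wlie (gamma1 x) yG _.
have Wid k x y : y \in gamma g k -> W k.+1 (lie (i x) (d y)).
  move=> yG; rewrite lie_hom_diff_half; apply: (subspaceZ _ (sW _)).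
  by apply: (subspaceD (sW _)); [exact: Wdiff (gammaS0 _ yG) | exact: Wdd].
have Wd k x u : W k u -> W k.+1 (lie (d x) u).
  move=> Wu; apply: (Wgen _ _ _ Wu (subspace_lier (d x) (sW k.+1))).
  move=> _ [y yG|y yG|a b y z yG zG kab].
  - rewrite lieC lie_hom_diff_half lieC [lie (d y) _]lieC raddfN -opprD.
    apply: (subspaceN (sW _)); apply: (subspaceZ _ (sW _)).
    apply: (subspaceN (sW _)); apply: (subspaceD (sW _)); last exact: Wdd.
    exact: Wdiff (gammaS0 _ yG).
  - exact: Wdd.
  - rewrite lieC hom_diff_triple -raddfN -lieC; apply: Wdiff; apply: gammaS0.
    by case: k kab {Wu} => // k kab; apply: gamma_leq (gammaM yG zG).
have raise k v u : (exists x, v = i x \/ v = psi x) -> W k u ->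
  W k.+1 (lie v u).
  have Wi x : W k u -> W k.+1 (lie (i x) u).
    move=> Wu; apply: (Wgen _ _ _ Wu (subspace_lier (i x) (sW k.+1))).
    move=> _ [y yG|y yG|a b y z yG zG kab].
    - by rewrite -lie_morph; apply: Whom (gammaS0 _ yG).
    - exact: Wid.
    - rewrite lie_deriv !lie_hom_diff_half lieZl lieZr lieDl lieDr.
      apply: (subspaceD (sW _)); apply: (subspaceZ _ (sW _));
        apply: (subspaceD (sW _)).
      + by apply: Wlie (gammaS x yG) zG _.
      + rewrite hom_diff_triple; apply: (Wtriple _ _ _ _ _ (gammaS x yG) zG).
        by rewrite addSn.
      + by apply: Wlie yG (gammaS x zG) _; rewrite addnS.
      + rewrite lieC hom_diff_triple -raddfN -lieC.
        by apply: (Wtriple _ _ _ _ _ yG (gammaS x zG)); rewrite addnS.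
  case=> x [] -> Wu; first exact: Wi.
  have -> : psi x = i x - d x by rewrite /d; lmod.
  by rewrite lieDl lieNl; apply: (subspaceB (sW _)); [apply: Wi | apply: Wd].
have allW : forall u, W 1%N u.
  move=> u; apply: (gen u (W 1%N)); first split => //.
    by move=> v w _ Ww;
      exact: (decW _ _ (lie_gen_raises sW decW raise (gen v) Ww)).
  move=> _ [x [->|->]]; first exact: Whom.
  have -> : psi x = i x - d x by rewrite /d; lmod.
  by apply: (subspaceB (sW _)); [apply: Whom | apply: Wdiff].
apply: (@gamma_ind _ _ W) => // k u v Wv.
exact: (lie_gen_raises sW decW raise (gen u)).
Qed.

End WeaklyCommuting.
(** * The universal algebra on a Lie triple system *)

Section TripleEnvelope.
Variables (K : fieldType) (g : lieAlgType K).
Implicit Types (x y z : g).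

(** A map that respects the structure of Lie triple system given by [[x, y], z],
    but in general not the bracket; hom_diff is one. *)
Definition triple_map (M : lieAlgType K) (d : g -> M) : Prop :=
  linear d /\ forall x y z, lie (lie (d x) (d y)) (d z) = d (lie (lie x y) z).

Inductive triple_rel : free_lie K g -> Prop :=
| triple_linear a x y : triple_rel
    (free_var K (a *: x + y) - (a *: free_var K x + free_var K y))
| triple_lie x y z : triple_rel
    (lie (lie (free_var K x) (free_var K y)) (free_var K z)
     - free_var K (lie (lie x y) z)).

Definition envelope : lieAlgType K := lie_quot (ideal_gen triple_rel).
Definition env_d x : envelope := lie_pi _ (free_var K x).
Local Notation d := env_d.

Lemma env_relE s t :
  triple_rel (s - t) -> lie_pi (ideal_gen triple_rel) s = lie_pi _ t.
Proof. by move=> st; apply/eqP; rewrite lie_pi_eq mem_ideal_gen. Qed.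

Lemma env_d_linear : linear d.
Proof. by move=> a x y; rewrite -linearP; apply/env_relE; constructor. Qed.
HB.instance Definition _ := GRing.isLinear.Build K g envelope _ d env_d_linear.

Lemma env_triple x y z : lie (lie (d x) (d y)) (d z) = d (lie (lie x y) z).
Proof.
pose v := @free_var K g.
apply: (@etrans _ _ (lie_pi _ (lie (lie (v x) (v y)) (v z)))).
  by rewrite !lie_morph.
exact/env_relE/triple_lie.
Qed.

Lemma env_gen (u : envelope) : lie_gen (fun v => exists x, v = d x) u.
Proof.
move=> P sP PS; apply: (quot_gen (@free_lie_gen _ _)) => // _ [_ [x ->] ->].
by apply: PS; exists x.
Qed.

Lemma env_ind (P : envelope -> Prop) : subalgebra P ->
  (forall x, P (d x)) -> forall u, P u.
Proof. by move=> sP Pd u; apply: env_gen => // _ [x ->]. Qed.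

Section Lift.
Variables (M : lieAlgType K) (f : g -> M) (tf : triple_map f).

Lemma env_lift_subproof :
  {subset ideal_gen triple_rel <= lie_ker (free_lift f)}.
Proof.
case: tf => lf trf; apply: ideal_gen_sub => _ [a x y|x y z];
  rewrite unfold_in raddfB /= subr_eq0; apply/eqP.
- by rewrite linearP /= !free_liftE lf.
- by rewrite !lie_morph /= !free_liftE trf.
Qed.

Definition env_lift : lieHom envelope M := quot_lift env_lift_subproof.

Lemma env_liftE x : env_lift (d x) = f x.
Proof. exact: etrans (quot_liftE env_lift_subproof _) (free_liftE _ _). Qed.

End Lift.

(** The first component is d, and the second one is the derivation that ad y
    should induce. *)
Definition env_tangent y x : sdprod (adjoint envelope) := (d x, d (lie y x)).

Lemma env_tangent_triple y : triple_map (env_tangent y).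
Proof.
split=> [a u v|u v w]; congr pair => /=; rewrite ?env_triple //.
- exact: linearP.
- by rewrite lieDr lieZr linearP.
rewrite !addr0 /adj_act !(lieDr, lieNr).
rewrite (lie_deriv y (lie u v)) (lie_deriv y u v) lieDl !raddfD /= -!env_triple.
rewrite [lie (d w) _]lieC [lie (d w) (lie (d v) _)]lieC.
by rewrite [lie (d v) (d (lie y u))]lieC lieNl; lmod.
Qed.

Definition env_der y (u : envelope) : envelope :=
  (env_lift (env_tangent_triple y) u).2.

Lemma env_der_fst y u : (env_lift (env_tangent_triple y) u).1 = u.
Proof.
move: u; apply: env_ind => [|x]; last by rewrite env_liftE.
split; first split; first by rewrite raddf0.
- by move=> a v w ev ew; rewrite linearP /= ev ew.
- by move=> v w ev ew; rewrite lie_morph /= ev ew.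
Qed.

Lemma env_der_d y x : env_der y (d x) = d (lie y x).
Proof. by rewrite /env_der env_liftE. Qed.

Lemma env_der_linear y : linear (env_der y).
Proof. by move=> a u v; rewrite /env_der linearP. Qed.

Lemma env_derP y a u v : env_der y (a *: u + v) =
  a *: env_der y u + env_der y v.
Proof. exact: env_der_linear. Qed.

Lemma env_der0 y : env_der y 0 = 0.
Proof. by rewrite /env_der raddf0. Qed.

Lemma env_derD y u v : env_der y (u + v) = env_der y u + env_der y v.
Proof. by rewrite /env_der raddfD. Qed.

Lemma env_derZ y a u : env_der y (a *: u) = a *: env_der y u.
Proof. by rewrite -[a *: u]addr0 env_derP env_der0 addr0. Qed.

Lemma env_der_lie y u v :
  env_der y (lie u v) = lie (env_der y u) v + lie u (env_der y v).
Proof.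
rewrite {1}/env_der lie_morph sdlieE !env_der_fst /=.
by rewrite abelE addr0 /adj_act -!/(env_der _ _) [lie v _]lieC opprK addrC.
Qed.

Lemma env_derDl a y z u :
  env_der (a *: y + z) u = a *: env_der y u + env_der z u.
Proof.
move: u; apply: env_ind => [|x]; last first.
  by rewrite !env_der_d lieDl lieZl linearP.
split=> [|u v IHu IHv].
  split=> [|b u v IHu IHv]; first by rewrite !env_der0 scaler0 addr0.
  by rewrite !env_derP IHu IHv; lmod.
by rewrite !env_der_lie IHu IHv !(lieDl, lieZl, lieDr, lieZr); lmod.
Qed.

Lemma env_der_bracket y z u :
  env_der (lie y z) u = env_der y (env_der z u) - env_der z (env_der y u).
Proof.
move: u; apply: env_ind => [|x]; last first.
  by rewrite !env_der_d lie_lie raddfB.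
split=> [|u v IHu IHv].
  split=> [|b u v IHu IHv]; first by rewrite !env_der0 subrr.
  by rewrite !env_derP IHu IHv; lmod.
rewrite !env_der_lie IHu IHv !env_derD !env_der_lie.
by rewrite !(lieDl, lieNl, lieDr, lieNr); lmod.
Qed.

(** On generators this is the triple relation. *)
Lemma env_der_inner y z u : env_der (lie y z) u = lie (lie (d y) (d z)) u.
Proof.
move: u; apply: env_ind => [|x]; last by rewrite env_der_d env_triple.
split=> [|u v IHu IHv].
  split=> [|b u v IHu IHv]; first by rewrite env_der0 liex0.
  by rewrite env_derP IHu IHv lieDr lieZr.
by rewrite env_der_lie IHu IHv -lie_deriv.
Qed.

Hypothesis two_neq0 : (2 : K) != 0.

(** The action that chi g forces on its ideal L(g), as computed by
    lie_hom_diff_half. *)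
Definition env_act y u : envelope := 2^-1 *: (env_der y u + lie (d y) u).

Lemma env_act_linearl u : linear (env_act^~ u).
Proof.
move=> a y z; rewrite /env_act env_derDl linearP /= lieDl lieZl; lmod.
Qed.

Lemma env_act_linearr y : linear (env_act y).
Proof. by move=> a u v; rewrite /env_act env_derP lieDr lieZr; lmod. Qed.

Lemma env_act_deriv y u v :
  env_act y (lie u v) = lie (env_act y u) v + lie u (env_act y v).
Proof.
rewrite /env_act env_der_lie lie_deriv !(lieDl, lieZl, lieDr, lieZr); lmod.
Qed.

Lemma env_act_lie y z u : env_act (lie y z) u
  = env_act y (env_act z u) - env_act z (env_act y u).
Proof.
apply: (scalerI (mulf_neq0 two_neq0 two_neq0)).
rewrite {1}/env_act scalerA mulfK //.
have E v w : (2 * 2) *: env_act v (env_act w u) =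
    env_der v (env_der w u) + lie (env_der v (d w)) u
    + lie (d w) (env_der v u) + lie (d v) (env_der w u)
    + lie (d v) (lie (d w) u).
  rewrite /env_act env_derZ lieZr -scalerDr !scalerA.
  by rewrite mulfK // divff // scale1r env_derD env_der_lie lieDr; lmod.
rewrite scalerBr !E !env_der_d [lie z y]lieC raddfN lieNl /=.
(* The commutator of the derivations D_y and D_z also equals that of ad (d y)
   and ad (d z), so the difference of these commutators may be added. *)
have D := env_der_bracket y z u.
have J := lie_lie (d y) (d z) u; rewrite -env_der_inner D in J.
rewrite -[RHS]addr0 -(subrr (lie (d y) (lie (d z) u)
  - lie (d z) (lie (d y) u))).
by rewrite -{1}J D scaler_nat; lmod.
Qed.

Definition env_action : lie_action g envelope :=
  LieAction env_act_linearl env_act_linearr env_act_deriv env_act_lie.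

Local Notation M := (sdprod env_action).

(** The image of x^psi in the semidirect product: with x sent to (x, 0), the
    difference of the two is d x. *)
Definition env_psi_fun x : M := (x, - d x).

Lemma env_psi_linear : linear env_psi_fun.
Proof. by move=> a x y; congr pair => /=; rewrite linearP /=; lmod. Qed.

Lemma env_psi_lie : {morph env_psi_fun : x y / lie x y >-> lie x y}.
Proof.
move=> x y; congr pair => /=; rewrite /env_act.
have N v w : env_der v (- w) = - env_der v w.
  by rewrite -scaleN1r env_derZ scaleN1r.
rewrite !N !env_der_d !(lieNl, lieNr) opprK [lie y x]lieC raddfN /=.
rewrite [lie (d y) (d x)]lieC -scalerBr.
rewrite [X in 2^-1 *: X](_ : _ = 2 *: (- d (lie x y) - lie (d x) (d y))).
  by rewrite scalerA mulVf // scale1r subrK.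
by rewrite scaler_nat; lmod.
Qed.

Definition env_psi : lieHom g M := lie_hom_of env_psi_linear env_psi_lie.

Lemma chi_env_subproof :
  {subset ideal_gen (@chi_rel K g)
     <= lie_ker (freeprod_lift (sd_inl env_action) env_psi)}.
Proof.
apply: ideal_gen_sub => _ [x].
rewrite unfold_in lie_morph freeprod_lift_inl freeprod_lift_inr /=.
apply/eqP; congr pair => /=; first exact: liexx.
rewrite lie0x /env_act env_der0 liex0 -scaleN1r env_derZ lieZr.
by rewrite env_der_d !liexx raddf0 !scaler0 !addr0 scaler0 subrr.
Qed.

Definition chi_env : lieHom (chi g) M := quot_lift chi_env_subproof.

Lemma chi_env_in x : chi_env (chi_in x) = (x, 0).
Proof.
exact: etrans (quot_liftE chi_env_subproof _) (freeprod_lift_inl _ _ _).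
Qed.
Lemma chi_env_psi x : chi_env (chi_psi x) = (x, - d x).
Proof.
exact: etrans (quot_liftE chi_env_subproof _) (freeprod_lift_inr _ _ _).
Qed.

End TripleEnvelope.

(** * The ideal L(g) is the universal algebra on a Lie triple system *)

Section ChiKernel.
Variables (K : fieldType) (g : lieAlgType K).
Hypothesis two_neq0 : (2 : K) != 0.
Implicit Types (x y z : g) (u v : chi g) (l : chi_L g).

Lemma chi_in_linear : linear (@chi_in K g).
Proof.
exact: (linearP (lie_pi (ideal_gen (@chi_rel K g)) \o @freeprod_inl K g g)).
Qed.
Lemma chi_in_lie : {morph @chi_in K g : x y / lie x y >-> lie x y}.
Proof. by move=> x y; rewrite /chi_in !lie_morph. Qed.
Definition chi_in_hom : lieHom g (chi g) := lie_hom_of chi_in_linear chi_in_lie.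

Lemma chi_psi_linear : linear (@chi_psi K g).
Proof.
exact: (linearP (lie_pi (ideal_gen (@chi_rel K g)) \o @freeprod_inr K g g)).
Qed.
Lemma chi_psi_lie : {morph @chi_psi K g : x y / lie x y >-> lie x y}.
Proof. by move=> x y; rewrite /chi_psi !lie_morph. Qed.
Definition chi_psi_hom : lieHom g (chi g) :=
  lie_hom_of chi_psi_linear chi_psi_lie.

Lemma chi_commute x : lie (chi_in_hom x) (chi_psi_hom x) = 0.
Proof.
apply: (@etrans _ _ (lie_pi (ideal_gen (@chi_rel K g))
  (lie (freeprod_inl g x) (freeprod_inr g x)))).
  by rewrite lie_morph.
apply/eqP; rewrite -(raddf0 (lie_pi _)) lie_pi_eq subr0.
exact: mem_ideal_gen.
Qed.

Lemma chi_gen u :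
  lie_gen (fun v => exists x, v = chi_in_hom x \/ v = chi_psi_hom x) u.
Proof.
move=> P sP PS.
apply: (quot_gen (quot_gen (@free_lie_gen _ _))) => // _ [_ [_ [x ->] ->] ->].
by apply: PS; case: x => x; exists x; [left | right].
Qed.

Lemma chi_ind (P : chi g -> Prop) : subalgebra P ->
  (forall x, P (chi_in x)) -> (forall x, P (chi_psi x)) -> forall u, P u.
Proof.
move=> sP Pi Ppsi u; apply: (chi_gen u) => // _ [x [->|->]].
- exact: Pi.
- exact: Ppsi.
Qed.

Definition chi_d : g -> chi g := hom_diff chi_in_hom chi_psi_hom.

Lemma chi_d_gamma2 x y : chi_d (lie x y) \in gamma (chi g) 2.
Proof. by rewrite /chi_d /hom_diff !lie_morph; apply: gammaB;
  apply: gamma2. Qed.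

Lemma chi_alpha_d x : chi_alpha g (chi_d x) = 0.
Proof.
rewrite /chi_d /hom_diff raddfB; apply/eqP; rewrite subr_eq0; apply/eqP.
exact: etrans (chi_alpha_in x) (esym (chi_alpha_psi x)).
Qed.

Lemma kernel_d_subproof x : chi_d x \in lie_ker (chi_alpha g).
Proof. by rewrite unfold_in chi_alpha_d. Qed.

Definition kernel_d x : chi_L g := IdealAlg (kernel_d_subproof x).
Local Notation d := kernel_d.

Lemma kernel_d_linear : linear d.
Proof. by move=> a x y; apply: val_inj; exact: hom_diff_linear. Qed.

Lemma kernel_d_triple : triple_map d.
Proof.
split=> [|x y z]; first exact: kernel_d_linear.
by apply: val_inj; exact: (hom_diff_triple chi_commute).
Qed.

(** Any element of chi g is the sum of one of g and of one generated by the d x;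
    alpha is injective on the former and vanishes on the latter. *)
Lemma kernel_gen l : lie_gen (fun l => exists x, l = d x) l.
Proof.
case: (hom_diff_gen chi_commute two_neq0 chi_gen (val l)) => x [v [Jv def_l]].
have alpha_v : v \in lie_ker (chi_alpha g).
  apply: (Jv (fun v => v \in lie_ker (chi_alpha g))).
    exact: subalgebra_ideal.
  by move=> _ [y ->]; apply: kernel_d_subproof.
have x0 : x = 0.
  have alpha_l : chi_alpha g (chi_in_hom x) + chi_alpha g v = 0.
    by apply/eqP; rewrite -raddfD -def_l; apply: (valP l).
  move: alpha_l; rewrite (eqP alpha_v : chi_alpha g v = 0) addr0.
  exact: etrans (esym (chi_alpha_in x)).
move=> P [[P0 PD] PL] PS.
have [l' Pl' vl'] : exists2 l', P l' & v = val l'.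
  apply: (Jv (fun v => exists2 l', P l' & v = val l')).
    split; first split; first by exists 0.
    - by move=> a _ _ [s Ps ->] [t Pt ->]; exists (a *: s + t) => //; apply: PD.
    - by move=> _ _ [s Ps ->] [t Pt ->]; exists (lie s t) => //; apply: PL.
  by move=> _ [y ->]; exists (d y) => //; apply: PS; exists y.
suff -> : l = l' by [].
by apply: val_inj; rewrite def_l x0 raddf0 add0r.
Qed.

Lemma chi_env_fst u : (chi_env g two_neq0 u).1 = chi_alpha g u.
Proof.
move: u; apply: chi_ind => [|x|x].
- split; first split; first by rewrite !raddf0.
    by move=> a v w ev ew; rewrite !linearP /= ev ew.
  by move=> v w ev ew; rewrite !lie_morph /= ev ew.
- exact: etrans (congr1 fst (chi_env_in two_neq0 x)) (esym (chi_alpha_in x)).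
- exact: etrans (congr1 fst (chi_env_psi two_neq0 x)) (esym (chi_alpha_psi x)).
Qed.

Section Lift.
Variables (M : lieAlgType K) (f : g -> M) (tf : triple_map f).

(** On the kernel of alpha, chi_env takes its values in the ideal of the
    semidirect product that is a copy of the envelope. *)
Definition kernel_lift_fun l : M := env_lift tf (chi_env g two_neq0 (val l)).2.

Lemma kernel_lift_linear : linear kernel_lift_fun.
Proof. by move=> a s t; rewrite /kernel_lift_fun !linearP. Qed.

Lemma kernel_lift_lie : {morph kernel_lift_fun : s t / lie s t >-> lie s t}.
Proof.
have fst0 (s : chi_L g) : (chi_env g two_neq0 (val s)).1 = 0.
  by rewrite chi_env_fst; apply/eqP; exact: (ideal_valP s).
move=> s t; rewrite /kernel_lift_fun (lie_morph (val s)).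
rewrite sdlieE !fst0 !act0l subrr add0r; exact: lie_morph.
Qed.

Definition kernel_lift : lieHom (chi_L g) M :=
  lie_hom_of kernel_lift_linear kernel_lift_lie.

Lemma kernel_liftE x : kernel_lift (d x) = f x.
Proof.
apply: etrans (env_liftE tf x); congr (env_lift tf _).
change ((chi_env g two_neq0 (chi_d x)).2 = env_d x).
rewrite /chi_d /hom_diff raddfB; set u := (X in (X - _).2);
  set v := (X in _ - X).
have -> : u = (x, 0) by apply: chi_env_in.
have -> : v = (x, - env_d x) by apply: chi_env_psi.
by rewrite /= sub0r opprK.
Qed.

End Lift.
End ChiKernel.

(** * Linear, odd and quadratic parts of elements of a free algebra *)

Section TripleMapNilpotent.
Variables (K : fieldType) (g C : lieAlgType K) (d : g -> C).
Hypotheses (td : triple_map d) (g4 : forall x, x \in gamma g 4 -> x = 0).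

Lemma triple_map0 : d 0 = 0.
Proof.
by case: td => ld _; have := ld (-1) 0 0; rewrite !scaleN1r !addNr.
Qed.

Lemma triple_mapD x y : d (x + y) = d x + d y.
Proof. by case: td => ld _; have := ld 1 x y; rewrite !scale1r. Qed.

Lemma triple_mapZ a x : d (a *: x) = a *: d x.
Proof. by case: td => ld _; have := ld a x 0; rewrite triple_map0 !addr0. Qed.

Lemma triple_mapN x : d (- x) = - d x.
Proof. by rewrite -scaleN1r triple_mapZ scaleN1r. Qed.

Lemma triple_mapr x y z : lie (d x) (lie (d y) (d z)) = d (lie x (lie y z)).
Proof.
by case: td => _ trd; rewrite lieC trd -triple_mapN -lieC.
Qed.

(** Take y = [c, [z, w]]; expand [[d x, d c], [d z, d w]] along either factor:
    by the triple relation, all terms but [d x, d y] involve the image under d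
    of an element of degree four. *)
Lemma triple_map_gamma23 x y :
  x \in gamma g 2 -> y \in gamma g 3 -> lie (d x) (d y) = 0.
Proof.
have [ld trd] := td.
have d4 v : v \in gamma g 4 -> d v = 0 by move=> /g4 ->; apply: triple_map0.
have sub0 c : subspace (fun y => forall x, x \in gamma g 2 ->
    lie (d x) (d (lie c y)) = 0).
  split=> [|a u v IHu IHv] t tG; first by rewrite liex0 triple_map0 liex0.
  by rewrite lieDr lieZr ld lieDr lieZr IHu ?IHv // scaler0 addr0.
have sub : subspace (fun y => forall x, x \in gamma g 2 -> lie (d x) (d y) = 0).
  split=> [|a u v IHu IHv] t tG; first by rewrite triple_map0 liex0.
  by rewrite ld lieDr lieZr IHu ?IHv // scaler0 addr0.
move=> + yG; move: y yG x; apply: (gamma_elim sub) => c.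
apply: (gamma_elim (sub0 c)) => z w _ x xG.
have xcG u : lie (lie x c) u \in gamma g 4.
  by rewrite lieC rpredN gammaS // lieC rpredN gammaS.
have := lie_lie (d x) (d c) (lie (d z) (d w)).
rewrite (lie_deriv (lie (d x) (d c))) !trd !triple_mapr
  !(d4 (lie (lie x c) _)) //.
rewrite (d4 (lie x _)) ?lie0x ?liex0 ?addr0 ?subr0 //.
exact: (@gammaM _ _ 1 1 _ _ xG (gamma2 z w)).
Qed.

End TripleMapNilpotent.

Section LinearPart.
Variables (K : fieldType).

Lemma abel_gamma2 (V : lmodType K) x : x \in gamma (abel V) 2 -> x = 0.
Proof.
have sub : subspace (fun x : abel V => x = 0).
  by split=> // a u v -> ->; rewrite scaler0 addr0.
exact: (gamma_elim sub).
Qed.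

Variables (r c : nat).

Lemma linear_part_subproof (V : lmodType K) (f : 'I_r -> abel V) u :
  u \in gamma (free_lie K 'I_r) c.+2 -> free_lift f u = 0.
Proof.
move=> uG; apply/abel_gamma2/gamma_morph.
exact: gamma_leq uG.
Qed.

(** The projection of a free nilpotent algebra on its abelianization, in the
    coordinates given by the generators. *)
Definition linear_part : lieHom (free_nilpotent K r c.+1) (abel 'rV[K]_r) :=
  nlift (linear_part_subproof (fun i => delta_mx 0 i : abel 'rV[K]_r)).

Lemma linear_part_lie x y : linear_part (lie x y) = 0.
Proof. by rewrite lie_morph abelE. Qed.

End LinearPart.

Section QuadraticPart.
Variables (K : fieldType) (m N : nat) (pr : 'I_N -> 'I_m * 'I_m).

Local Notation B := (abel ('rV[K]_m * 'rV[K]_N)%type).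

Definition minor_act (a : abel 'rV[K]_m) (b : B) : B :=
  (0, \row_k (a 0 (pr k).1 * b.1 0 (pr k).2)).

Lemma minor_act_linearl b : linear (minor_act^~ b).
Proof.
move=> k u v; congr pair; first by rewrite /= scaler0 addr0.
by apply/rowP => i; rewrite !mxE mulrDl mulrA.
Qed.

Lemma minor_act_linearr a : linear (minor_act a).
Proof.
move=> k u v; congr pair; first by rewrite /= scaler0 addr0.
by apply/rowP => i; rewrite !mxE /= ?mxE; ring.
Qed.

Lemma minor_act_deriv a b c :
  minor_act a (lie b c) = lie (minor_act a b) c + lie b (minor_act a c).
Proof.
rewrite !abelE addr0; congr pair.
by apply/rowP => i; rewrite !mxE mulr0.
Qed.

Lemma minor_act_lie a a' b : minor_act (lie a a') b
  = minor_act a (minor_act a' b) - minor_act a' (minor_act a b).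
Proof.
congr pair; first by rewrite /= subrr.
by apply/rowP => i; rewrite abelE !mxE /= ?mxE; ring.
Qed.

Definition minor_action : lie_action (abel 'rV[K]_m) B :=
  LieAction minor_act_linearl minor_act_linearr minor_act_deriv minor_act_lie.

Local Notation F := (free_lie K 'I_m).

Definition quadratic_hom : lieHom F (sdprod minor_action) :=
  free_lift (fun i => (delta_mx 0 i, (delta_mx 0 i, 0)) : sdprod minor_action).

Lemma quadratic_homE i :
  quadratic_hom (free_var K i) = (delta_mx 0 i, (delta_mx 0 i, 0)).
Proof. exact: free_liftE. Qed.

(** The coefficients of the brackets of two generators selected by pr: a
    bracket of elements with linear parts a and b has as its coordinates the
    two by two minors of the matrix with rows a and b. *)
Definition quadratic_part (u : F) : 'rV[K]_N := (quadratic_hom u).2.2.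

Lemma quadratic_part_linear : linear quadratic_part.
Proof. by move=> a u v; rewrite /quadratic_part linearP. Qed.

Lemma quadratic_part_var i : quadratic_part (free_var K i) = 0.
Proof. by rewrite /quadratic_part quadratic_homE. Qed.

Lemma quadratic_part_bracket i j k :
  quadratic_part (lie (free_var K i) (free_var K j)) 0 k
  = ((pr k == (i, j))%:R - (pr k == (j, i))%:R).
Proof.
rewrite /quadratic_part lie_morph !quadratic_homE /= !mxE /=.
by rewrite addr0 -!natrM !mulnb -!xpair_eqE -surjective_pairing.
Qed.

Lemma quadratic_part_gamma3 u : u \in gamma F 3 -> quadratic_part u = 0.
Proof.
have gamma2_fst w : w \in gamma F 2 ->
    (quadratic_hom w).1 = 0 /\ (quadratic_hom w).2.1 = 0.
  have sub : subspace (fun w =>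
    (quadratic_hom w).1 = 0 /\ (quadratic_hom w).2.1 = 0).
    split=> [|a s t [s1 s2] [t1 t2]]; first by rewrite raddf0.
    by rewrite linearP /= s1 s2 t1 t2 !scaler0 !addr0.
  apply: (gamma_elim sub) => s t _; rewrite lie_morph /= abelE subrr addr0.
  by [].
have sub : subspace (fun w => quadratic_part w = 0).
  split=> [|a s t s0 t0]; first by rewrite /quadratic_part raddf0.
  by rewrite quadratic_part_linear s0 t0 scaler0 addr0.
move: u; apply: (gamma_elim sub) => s t /gamma2_fst[t1 t2].
rewrite /quadratic_part lie_morph /= t1 t2; apply/rowP => k.
by rewrite !mxE; ring.
Qed.

End QuadraticPart.

Section OddPart.
Variables (K : fieldType) (m : nat).
Hypothesis two_neq0 : (2 : K) != 0.

Local Notation F := (free_lie K 'I_m).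
Local Notation N := (free_nilpotent K m 4).

Definition nil_pi : lieHom F N := lie_pi _.
Definition nil_sgn : lieHom F N := free_lift (fun i => - nvar K 4 i).

Lemma nil_sgnE i : nil_sgn (free_var K i) = - nvar K 4 i.
Proof. exact: free_liftE. Qed.

(** The even and the odd part of the image of u for the sign change of the
    generators. *)
Definition even_part u := 2^-1 *: (nil_pi u + nil_sgn u).
Definition odd_part u := 2^-1 *: (nil_pi u - nil_sgn u).

Lemma odd_part_linear : linear odd_part.
Proof. by move=> a u v; rewrite /odd_part !linearP /=; lmod. Qed.

Lemma nil_pi_half u : nil_pi u = even_part u + odd_part u.
Proof.
rewrite /even_part /odd_part -scalerDr (_ : _ + _ = 2 *: nil_pi u).
  by rewrite scalerA mulVf ?scale1r.
by rewrite scaler_nat; lmod.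
Qed.

Lemma nil_sgn_half u : nil_sgn u = even_part u - odd_part u.
Proof.
rewrite /even_part /odd_part -scalerBr (_ : _ - _ = 2 *: nil_sgn u).
  by rewrite scalerA mulVf ?scale1r.
by rewrite scaler_nat; lmod.
Qed.

Lemma even_part_lie u v : even_part (lie u v)
  = lie (even_part u) (even_part v) + lie (odd_part u) (odd_part v).
Proof.
rewrite {1}/even_part !lie_morph !nil_pi_half !nil_sgn_half.
rewrite !(lieDl, lieDr, lieNl, lieNr).
rewrite [X in 2^-1 *: X](_ : _ = 2 *: (lie (even_part u) (even_part v)
  + lie (odd_part u) (odd_part v))); first by rewrite scalerA mulVf ?scale1r.
by rewrite scaler_nat; lmod.
Qed.

Lemma odd_part_lie u v : odd_part (lie u v)
  = lie (even_part u) (odd_part v) + lie (odd_part u) (even_part v).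
Proof.
rewrite {1}/odd_part !lie_morph !nil_pi_half !nil_sgn_half.
rewrite !(lieDl, lieDr, lieNl, lieNr).
rewrite [X in 2^-1 *: X](_ : _ = 2 *: (lie (even_part u) (odd_part v)
  + lie (odd_part u) (even_part v))); first by rewrite scalerA mulVf ?scale1r.
by rewrite scaler_nat; lmod.
Qed.

Lemma odd_part_var i : odd_part (free_var K i) = nvar K 4 i.
Proof.
rewrite /odd_part nil_sgnE opprK -mulr2n -scaler_nat scalerA.
by rewrite mulVf ?scale1r.
Qed.

Lemma even_part_var i : even_part (free_var K i) = 0.
Proof. by rewrite /even_part nil_sgnE subrr scaler0. Qed.

(** In degree n, the sign change of the generators is multiplication by the
    n-th power of -1. *)
Lemma nil_sgn_gamma k u : u \in gamma F k.+1 ->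
  nil_pi u + (-1) ^+ k *: nil_sgn u \in gamma N k.+2.
Proof.
pose W k u := nil_sgn u \in gamma N k /\
  nil_pi u + (-1) ^+ k.-1 *: nil_sgn u \in gamma N k.+1.
have sW j : subspace (W j).
  split=> [|a v w [Wv1 Wv] [Ww1 Ww]]; rewrite /W.
    by rewrite (raddf0 nil_pi) (raddf0 nil_sgn) scaler0 addr0 !rpred0.
  rewrite !linearP /=; split; first by rewrite rpredD ?rpredZ.
  rewrite [X in X \in _](_ : _ = a *: (nil_pi v + (-1) ^+ j.-1 *: nil_sgn v)
    + (nil_pi w + (-1) ^+ j.-1 *: nil_sgn w)); last by lmod.
  by rewrite rpredD ?rpredZ.
have W1 v : W 1%N v.
  apply: (free_lie_gen v); first split=> // s t _ _.
    by rewrite /W !lie_morph scale1r rpredD ?gamma2.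
  by move=> _ [i ->]; rewrite /W nil_sgnE scale1r subrr rpred0.
move=> uG; have [] : W k.+1 u; last by [].
move: k u uG; apply: (@gamma_ind _ _ W sW W1) => j s t [Wt1 Wt].
rewrite /W !lie_morph /=; split; first exact: gammaS.
set p := nil_pi t in Wt *; set q := nil_sgn t in Wt1 Wt *.
(* Replace p by the opposite of (-1) ^+ j *: q, then nil_pi s by - nil_sgn s:
   each replacement changes the bracket by an element of the next term of the
   lower central series. *)
have -> : lie (nil_pi s) p + (-1) ^+ j.+1 *: lie (nil_sgn s) q =
    lie (nil_pi s) (p + (-1) ^+ j *: q)
    - lie (nil_pi s + nil_sgn s) ((-1) ^+ j *: q).
  by rewrite exprS !(lieDl, lieDr, lieZr); lmod.
have [_] := W1 s; rewrite scale1r => Ws.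
have qG : (-1) ^+ j *: q \in gamma N j.+1 by rewrite rpredZ.
have tG := gammaS (nil_pi s) Wt; have sG := gammaM Ws qG.
by rewrite rpredB.
Qed.

Lemma even_part_gamma2 u : even_part u \in gamma N 2.
Proof. by have := nil_sgn_gamma (gamma1 u); rewrite scale1r => /rpredZ;
  apply. Qed.

Lemma odd_part_gamma4 u : u \in gamma F 4 -> odd_part u = 0.
Proof.
move=> /nil_sgn_gamma;
  rewrite -signr_odd expr1 scaleN1r => /free_nilpotent_gamma.
by rewrite /odd_part => ->; rewrite scaler0.
Qed.

(** The other terms in the expansion have two even factors, hence degree at
    least five. *)
Lemma odd_part_triple x y z : odd_part (lie (lie x y) z)
  = lie (lie (odd_part x) (odd_part y)) (odd_part z).
Proof.
have E v : even_part v \in gamma N 2 := even_part_gamma2 v.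
have zero v : v \in gamma N 5 -> v = 0 by apply: free_nilpotent_gamma.
rewrite odd_part_lie even_part_lie odd_part_lie.
rewrite (lieDl (lie (even_part x) _)) [X in X + _ + _](_ : _ = 0) ?add0r.
  rewrite [X in _ + X](_ : _ = 0) ?addr0 //; apply: zero.
  rewrite lieDl rpredD // (@gammaM _ _ 2 1) //; last exact: gammaS.
  by rewrite lieC rpredN gammaS.
by apply: zero; rewrite lieC rpredN gammaS // (@gammaM _ _ 1 1).
Qed.


End OddPart.

(** * The model of L(h) *)

Section Model.
Variables (K : fieldType) (m N : nat).
Hypothesis two_neq0 : (2 : K) != 0.

Local Notation F := (free_lie K 'I_m).
Local Notation h := (free_nilpotent K m 3).
Local Notation n4 := (free_nilpotent K m 4).
Local Notation n2 := (free_nilpotent K N 2).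
Local Notation Mx := (abel 'M[K]_(m, N)).

Definition tensor (a : n4) (b : n2) : 'M[K]_(m, N) :=
  (linear_part K m 3 a : 'rV[K]_m)^T *m (linear_part K N 1 b : 'rV[K]_N).

Lemma tensor_linearl b : linear (tensor^~ b).
Proof.
by move=> k u v; rewrite /tensor !linearP /= mulmxDl -scalemxAl.
Qed.

Lemma tensor_linearr a : linear (tensor a).
Proof. by move=> k u v; rewrite /tensor linearP /= mulmxDr -scalemxAr. Qed.

Lemma tensor_liel a a' b : tensor (lie a a') b = 0.
Proof. by rewrite /tensor linear_part_lie (trmx0 K) mul0mx. Qed.

Lemma tensor_lier a b b' : tensor a (lie b b') = 0.
Proof. by rewrite /tensor linear_part_lie mulmx0. Qed.

Lemma tensor0l b : tensor 0 b = 0.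
Proof. by rewrite -(lie0x 0) tensor_liel. Qed.

Lemma tensor0r a : tensor a 0 = 0.
Proof. by rewrite -(lie0x 0) tensor_lier. Qed.

Lemma tensor_var i k : tensor (nvar K 4 i) (nvar K 2 k) = delta_mx i k.
Proof.
rewrite /tensor /linear_part !nliftE.
by rewrite trmx_delta mul_delta_mx.
Qed.

Definition model_act (a : n4) (b : n2 * Mx) : n2 * Mx := (0, tensor a b.1).

Lemma model_act_linearl b : linear (model_act^~ b).
Proof.
move=> k u v; congr pair; first by rewrite /= scaler0 addr0.
exact: tensor_linearl.
Qed.

Lemma model_act_linearr a : linear (model_act a).
Proof.
move=> k u v; congr pair; first by rewrite /= scaler0 addr0.
exact: tensor_linearr.
Qed.

Lemma model_act_deriv a b c :
  model_act a (lie b c) = lie (model_act a b) c + lie b (model_act a c).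
Proof.
congr pair; first by rewrite /= lie0x liex0 addr0.
by rewrite /= tensor_lier !abelE addr0.
Qed.

Lemma model_act_lie a a' b :
  model_act (lie a a') b =
    model_act a (model_act a' b) - model_act a' (model_act a b).
Proof.
congr pair; first by rewrite /= subrr.
by rewrite /= tensor_liel !tensor0r subrr.
Qed.

Definition model_action : lie_action n4 (n2 * Mx)%type :=
  LieAction model_act_linearl model_act_linearr model_act_deriv model_act_lie.

(** The extension of the direct sum of n4 and n2 by the cocycle that pairs the
    linear parts of its two summands. *)
Definition model : lieAlgType K := sdprod model_action.

Variables (pr : 'I_N -> 'I_m * 'I_m).

Local Notation q2 := (@quadratic_part K m N pr).

Definition free_to_model (u : F) : model :=
  (odd_part u, (\sum_k q2 u 0 k *: nvar K 2 k, 0)).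

Lemma free_to_model_linear : linear free_to_model.
Proof.
move=> a u v; congr pair; first exact: odd_part_linear.
congr pair; last by rewrite /= scaler0 addr0.
rewrite /= quadratic_part_linear scaler_sumr -big_split /=.
by apply: eq_bigr => k _; rewrite !mxE scalerDl scalerA.
Qed.

Lemma free_to_model_gamma4 u : u \in gamma F 4 -> free_to_model u = 0.
Proof.
move=> uG; rewrite /free_to_model odd_part_gamma4 //.
rewrite quadratic_part_gamma3 ?big1 //; last exact: gamma_dec.
by move=> k _; rewrite mxE scale0r.
Qed.

Lemma free_to_model_triple x y z : free_to_model (lie (lie x y) z)
  = lie (lie (free_to_model x) (free_to_model y)) (free_to_model z).
Proof.
rewrite !sdlieE /=; congr pair; first exact: odd_part_triple.
congr pair; last first.
  by rewrite /= tensor_liel !subrr !add0r tensor_lier !abelE oppr0 addr0.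

rewrite /= !subrr !add0r quadratic_part_gamma3; last first.
  by rewrite lieC rpredN; apply/gammaS/gamma2.
rewrite big1; last by move=> k _; rewrite mxE scale0r.
apply/esym/free_nilpotent_gamma.
by rewrite lieC rpredN; apply/gammaS/gamma2.
Qed.

(** The triple map from h to the model is the sum of the odd part, in n4, and
    of the quadratic part, in the span of the generators of n2. *)
Definition to_model (x : h) : model :=
  free_to_model (repr (x : Quotient.quot (gamma F 4))).

Lemma to_model_pi u : to_model (lie_pi _ u) = free_to_model u.
Proof.
rewrite /to_model; set v := repr _.
have /free_to_model_gamma4 : v - u \in gamma F 4 by apply: repr_pi.
have := free_to_model_linear (-1) u v;
  rewrite !scaleN1r [- u + v]addrC => -> /eqP.
by rewrite addrC subr_eq0 => /eqP.
Qed.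

Lemma to_model_triple : triple_map to_model.
Proof.
split=> [a|].
  elim/quotW => u; elim/quotW => v.
  have -> : a *: lie_pi (gamma F 4) u + lie_pi (gamma F 4) v
    = lie_pi _ (a *: u + v) by rewrite linearP.
  by rewrite !to_model_pi free_to_model_linear.
elim/quotW => u; elim/quotW => v; elim/quotW => w.
have -> : lie (lie (lie_pi (gamma F 4) u) (lie_pi (gamma F 4) v)) (lie_pi _ w)
  = lie_pi _ (lie (lie u v) w) by rewrite !lie_morph.
by rewrite !to_model_pi free_to_model_triple.
Qed.

Lemma to_model_var i : to_model (nvar K 3 i) = (nvar K 4 i, (0, 0)).
Proof.
rewrite /nvar to_model_pi /free_to_model odd_part_var // quadratic_part_var.
by rewrite big1 // => k _; rewrite mxE scale0r.
Qed.

Hypothesis pr_inj : injective pr.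
Hypothesis pr_lt : forall k, ((pr k).1 < (pr k).2)%N.

Lemma to_model_bracket k :
  to_model (lie (nvar K 3 (pr k).1) (nvar K 3 (pr k).2)) = (0, (nvar K 2 k, 0)).
Proof.
rewrite /nvar -lie_morph to_model_pi /free_to_model odd_part_lie //.
rewrite !even_part_var lie0x liex0 addr0; congr (_, (_, _)).
rewrite (bigD1 k) //= big1 ?addr0 => [|l l_neq_k].
  rewrite quadratic_part_bracket -surjective_pairing eqxx.
  rewrite (_ : pr k == _ = false) ?subr0 ?scale1r //.
  by apply/eqP => /(congr1 fst) /= prk; have := pr_lt k; rewrite prk ltnn.
rewrite quadratic_part_bracket -surjective_pairing (inj_eq pr_inj)
  (negPf l_neq_k).
rewrite (_ : pr l == _ = false) ?subr0 ?scale0r //.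
by apply/eqP => prl; have := pr_lt l; rewrite prl /= ltnNge ltnW ?pr_lt.
Qed.

End Model.

(** * A bracket of length four that does not vanish *)

Section Engel.
Variables (K : fieldType).

Local Notation A := (abel K^o).
Local Notation B := (abel {poly K}).

Definition shift_act (a : A) (p : B) : B := (a : K) *: ('X * (p : {poly K})).

Lemma shift_act_linearl p : linear (shift_act^~ p).
Proof. by move=> k a b; rewrite /shift_act scalerDl -scalerA. Qed.

Lemma shift_act_linearr a : linear (shift_act a).
Proof.
move=> k p q; rewrite /shift_act mulrDr scalerDr -scalerAr !scalerA.
by rewrite [k * _]mulrC.
Qed.

Lemma shift_act_deriv a p q :
  shift_act a (lie p q) = lie (shift_act a p) q + lie p (shift_act a q).
Proof. by rewrite !abelE addr0 /shift_act mulr0 scaler0. Qed.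

Lemma shift_act_lie a b p : shift_act (lie a b) p
  = shift_act a (shift_act b p) - shift_act b (shift_act a p).
Proof.
rewrite abelE /shift_act scale0r -!scalerAr !scalerA [X in X *: _ - _]mulrC.
by rewrite subrr.
Qed.

(** K acts on the polynomials through multiplication by the indeterminate, so
    that k.+1-fold brackets are divisible by the k-th power of it. *)
Definition shift_action : lie_action A B :=
  LieAction shift_act_linearl shift_act_linearr shift_act_deriv shift_act_lie.

Lemma shift_gamma k (x : sdprod shift_action) :
  x \in gamma (sdprod shift_action) k.+1 ->
  ((0 < k)%N -> x.1 = 0) /\ exists q : {poly K}, x.2 = 'X^k * q.
Proof.
pose W k (x : sdprod shift_action) :=
  ((1 < k)%N -> x.1 = 0) /\ exists q : {poly K}, x.2 = 'X^(k.-1) * q.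
move: k x; apply: (@gamma_ind _ _ W) => [k|x|k x y].
- split=> [|a u v [u1 [p up]] [v1 [q vq]]].
    by split=> //; exists 0; rewrite mulr0.
  split=> [k1|]; first by rewrite /= u1 // v1 // scaler0 addr0.
  by exists (a *: p + q); rewrite /= up vq mulrDr -scalerAr.
- by split=> //; exists x.2; rewrite mul1r.
- move=> [y1 [q yq]]; split=> //.
  case: k y1 yq => [|k] y1 yq.
    exists ((x.1 : K) *: (y.2 : {poly K}) - (y.1 : K) *: (x.2 : {poly K})).
    by rewrite /= /shift_act abelE addr0 mulrBr -!scalerAr.
  exists ((x.1 : K) *: q).
  rewrite /= /shift_act abelE addr0 y1 // scale0r subr0 yq exprS mulrA.
  by rewrite -scalerAr.
Qed.

Lemma free_nilpotent_engel m (i j : 'I_m) : i != j ->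
  lie (nvar K 4 i) (lie (nvar K 4 i) (lie (nvar K 4 i) (nvar K 4 j))) != 0.
Proof.
move=> ij; apply/eqP; set x := nvar K 4 i.
pose v := free_var K i; pose u := lie v (lie v (lie v (free_var K j))).
have -> : lie x (lie x (lie x (nvar K 4 j))) = lie_pi _ u.
  by rewrite /u !lie_morph.
move=> /eqP; rewrite -(raddf0 (lie_pi _)) lie_pi_eq subr0 => uG.
pose f : 'I_m -> sdprod shift_action :=
  fun k => if k == i then (1, 0) else (0, 1).
pose phi : lieHom (free_lie K 'I_m) (sdprod shift_action) := free_lift f.
have phiE k : phi (free_var K k) = f k by apply: free_liftE.
have [_ [q]] := shift_gamma (gamma_morph phi uG).
rewrite !lie_morph !phiE /f eqxx [j == i]eq_sym (negPf ij) /=.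
rewrite /shift_act !abelE !scale1r !scale0r !subr0 !addr0 mulr1.
change ('X^3 = 'X^4 * q -> False) => /(congr1 (fun p : {poly K} => p`_3)).
rewrite coefXnM coefXn /=.
by move/eqP; rewrite oner_eq0.
Qed.

End Engel.

(** * The isomorphism *)

Section Isomorphism.
Variables (K : fieldType) (m N : nat) (pr : 'I_N -> 'I_m * 'I_m).
Hypothesis two_neq0 : (2 : K) != 0.
Hypothesis pr_inj : injective pr.
Hypothesis pr_lt : forall k, ((pr k).1 < (pr k).2)%N.
Hypothesis pr_onto : forall i j : 'I_m, (i < j)%N -> exists k, pr k = (i, j).

Local Notation h := (free_nilpotent K m 3).
Local Notation n4 := (free_nilpotent K m 4).
Local Notation n2 := (free_nilpotent K N 2).
Local Notation Mx := (abel 'M[K]_(m, N)).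
Local Notation P := (model K m N).
Local Notation L := (chi_L h).
Local Notation d := (@kernel_d K h).
Local Notation x_ := (nvar K 3).
Local Notation e_ k := (lie (x_ (pr k).1) (x_ (pr k).2)).

Let dt : triple_map d := kernel_d_triple h.
Let h4 : forall x : h, x \in gamma h 4 -> x = 0 :=
  @free_nilpotent_gamma K m 3.

(** The layers of degree five vanish, the only delicate ones being those in
    which d is applied to elements of degrees two and three. *)
Lemma chi_gamma5 (u : chi h) : u \in gamma (chi h) 5 -> u = 0.
Proof.
have tc : triple_map (hom_diff (chi_in_hom h) (chi_psi_hom h)).
  split; first exact: hom_diff_linear.
  by move=> x y z; exact: (hom_diff_triple (@chi_commute K h)).
have h5 x : x \in gamma h 5 -> x = 0 by move=> /gamma_dec/h4.
move=> /(gamma_diff (@chi_commute K h) two_neq0 (@chi_gen K h)).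
move/(_ (fun u => u = 0)); apply.
  by split=> // a v w -> ->; rewrite scaler0 addr0.
move=> _ [x /h5 ->|x /h5 ->|a b x y xG yG ab].
- exact: raddf0.
- exact: (triple_map0 tc).
- case: (leqP 3 a) => [a3|a3].
    by rewrite (h4 (gamma_leq a3 xG)) (triple_map0 tc) lie0x.
  case: (leqP 3 b) => [b3|b3].
    by rewrite (h4 (gamma_leq b3 yG)) (triple_map0 tc) liex0.
  case: (leqP 2 b) => [b2|b2].
    have a1 : (1 <= a)%N by lia.
    exact: (triple_map_gamma23 tc h4 (gamma_leq a1 xG) (gamma_leq b2 yG)).
  have [a2 b1] : (2 <= a)%N /\ (1 <= b)%N by lia.
  rewrite lieC; apply/eqP; rewrite oppr_eq0; apply/eqP.
  exact: (triple_map_gamma23 tc h4 (gamma_leq b1 yG) (gamma_leq a2 xG)).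
Qed.

Lemma ideal_val_lie : {morph (@ideal_val K (chi h) (lie_ker (chi_alpha h)))
  : x y / lie x y >-> lie x y}.
Proof. by []. Qed.

Lemma ideal_val_linear :
  linear (@ideal_val K (chi h) (lie_ker (chi_alpha h))).
Proof. by []. Qed.

Definition kernel_in : lieHom L (chi h) :=
  lie_hom_of ideal_val_linear ideal_val_lie.

Lemma kernel_in_inj : injective kernel_in.
Proof. by move=> s t st; apply: val_inj. Qed.

Lemma kernel_gamma5 (l : L) : l \in gamma L 5 -> l = 0.
Proof.
move=> /(gamma_morph kernel_in)/chi_gamma5 l0.
by apply: kernel_in_inj; rewrite l0 raddf0.
Qed.

Lemma from_n4_subproof u : u \in gamma (free_lie K 'I_m) 5 ->
  free_lift (fun i => d (x_ i)) u = 0.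
Proof. by move=> /(gamma_morph (free_lift (fun i =>
  d (x_ i))))/kernel_gamma5. Qed.

Definition from_n4 : lieHom n4 L := nlift from_n4_subproof.

Lemma from_n4E i : from_n4 (nvar K 4 i) = d (x_ i).
Proof. exact: nliftE. Qed.

(** A difference taken at a bracket has degree two in chi, hence the third
    term of the central series of n2 is sent to degree six. *)
Lemma from_n2_subproof u : u \in gamma (free_lie K 'I_N) 3 ->
  free_lift (fun k => d (e_ k)) u = 0.
Proof.
pose f : lieHom (free_lie K 'I_N) L := free_lift (fun k => d (e_ k)).
pose W k u := kernel_in (f u) \in gamma (chi h) k.*2.
have sW k : subspace (W k).
  split=> [|a v w Wv Ww]; first by rewrite /W (raddf0 f) raddf0 rpred0.
  by rewrite /W (linearP f) linearP rpredD ?rpredZ.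
have W1 v : W 1%N v.
  refine (free_lie_gen v _ _); first split=> // s t Ws Wt.
    by rewrite /W (lie_morph s) lie_morph gamma2.
  move=> _ [k ->]; rewrite /W (_ : f _ = d (e_ k)); last exact: free_liftE.
  exact: chi_d_gamma2.
have W3 : W 3%N u -> f u = 0.
  move=> Wu; have u6 : kernel_in (f u) \in gamma (chi h) 6 := Wu.
  have u0 := chi_gamma5 (gamma_dec u6).
  by apply: kernel_in_inj; rewrite u0 raddf0.
move=> uG; apply: W3; move: u uG; apply: (@gamma_ind _ _ W sW W1 _ 2).
move=> k s t Wt; have Ws := W1 s; rewrite /W !lie_morph.
exact: (gammaM Ws Wt).
Qed.

Definition from_n2 : lieHom n2 L := nlift from_n2_subproof.

Lemma from_n2E k : from_n2 (nvar K 2 k) = d (e_ k).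
Proof. exact: nliftE. Qed.

(** By the triple relation, the bracket of d y with this element is the image
    under d of an element of degree four of h. *)
Lemma central_bracket i k (l : L) : lie l (lie (d (x_ i)) (d (e_ k))) = 0.
Proof.
refine (kernel_gen two_neq0 l (subalgebra_centraliser _) _).
move=> _ [y ->]; rewrite (triple_mapr dt).
by rewrite (h4 (gammaS y (gammaS (x_ i) (gamma2 _ _)))) (triple_map0 dt).
Qed.

Definition from_mx (c : Mx) : L :=
  \sum_i \sum_k (c : 'M_(m, N)) i k *: lie (d (x_ i)) (d (e_ k)).

Lemma from_mx_linear : linear from_mx.
Proof.
move=> a u v; rewrite /from_mx scaler_sumr -big_split; apply: eq_bigr => i _ /=.
rewrite scaler_sumr -big_split; apply: eq_bigr => k _ /=.
by rewrite !mxE scalerDl scalerA.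
Qed.

HB.instance Definition _ :=
  GRing.isLinear.Build K Mx L _ from_mx from_mx_linear.

Lemma from_mx0 : from_mx 0 = 0.
Proof. by have := from_mx_linear (-1) 0 0; rewrite !scaleN1r !addNr. Qed.

Lemma from_mx_central l c : lie l (from_mx c) = 0.
Proof.
have sum0 (I : finType) (f : I -> L) :
    (forall i, lie l (f i) = 0) -> lie l (\sum_i f i) = 0.
  move=> lf; apply: (big_ind (fun t => lie l t = 0)) => //.
  - exact: liex0.
  - by move=> u v lu lv; rewrite lieDr lu lv addr0.
by apply/sum0 => i; apply/sum0 => k; rewrite lieZr central_bracket scaler0.
Qed.

Lemma from_mx_delta i k : from_mx (delta_mx i k) = lie (d (x_ i)) (d (e_ k)).
Proof.
rewrite /from_mx (bigD1 i) //= [X in _ + X]big1 ?addr0 => [|j j_neq_i].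
  rewrite (bigD1 k) //= big1 ?addr0 => [|j j_neq_k].
    by rewrite mxE !eqxx scale1r.
  by rewrite mxE (negPf j_neq_k) andbF scale0r.
by rewrite big1 // => l _; rewrite mxE (negPf j_neq_i) scale0r.
Qed.

(** Both sides vanish when a or b is a bracket: on the left by the Jacobi
    identity, because the images of a generator of n4 and of one of n2 have a
    central bracket; on the right because only linear parts count. *)
Lemma from_n4_n2 a b : lie (from_n4 a) (from_n2 b) = from_mx (tensor a b).
Proof.
pose Q b := forall a, lie (from_n4 a) (from_n2 b) = from_mx (tensor a b).
suff : Q b by apply.
refine (nilpotent_gen b _ _).
  split=> [|u v Qu Qv].
    split=> [|k u v Qu Qv] t; first by rewrite raddf0 liex0 tensor0r from_mx0.
    rewrite linearP /= lieDr lieZr Qu Qv tensor_linearr.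
    exact: esym (from_mx_linear _ _ _).
  move=> t; rewrite lie_morph lie_deriv Qu Qv tensor_lier from_mx0.
  by rewrite lieC !from_mx_central oppr0 addr0.
move=> _ [k ->] {}a;
  refine (nilpotent_gen a (P := fun a =>
    lie (from_n4 a) _ = _ (tensor a _)) _ _).
  split=> [|u v Qu Qv].
    split=> [|c u v Qu Qv].
      by rewrite raddf0 lie0x tensor0l from_mx0.
    rewrite linearP /= lieDl lieZl Qu Qv.
    by rewrite (tensor_linearl _ c u v); apply: esym (from_mx_linear _ _ _).
  by rewrite lie_morph lie_lie Qu Qv !from_mx_central tensor_liel subrr
    from_mx0.
by move=> _ [i ->]; rewrite tensor_var from_mx_delta from_n4E from_n2E.
Qed.

Definition from_n2_mx_fun (b : n2 * Mx) : L := from_n2 b.1 + from_mx b.2.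

Lemma from_n2_mx_linear : linear from_n2_mx_fun.
Proof.
move=> a u v;
  rewrite /from_n2_mx_fun [from_mx _]from_mx_linear [from_n2 _]linearP.
by rewrite scalerDr addrACA.
Qed.

Lemma from_n2_mx_lie : {morph from_n2_mx_fun : u v / lie u v >-> lie u v}.
Proof.
move=> u v; rewrite /from_n2_mx_fun lieDr from_mx_central addr0.
rewrite [RHS]lieC lieDr from_mx_central addr0 -lieC.
rewrite [from_n2 _](_ : _ = lie (from_n2 u.1) (from_n2 v.1)); last first.
  exact: lie_morph.
by rewrite [from_mx _]from_mx0 addr0.
Qed.

Definition from_n2_mx : lieHom (n2 * Mx)%type L :=
  lie_hom_of from_n2_mx_linear from_n2_mx_lie.

Lemma from_model_subproof a b :
  from_n2_mx (model_action K m N a b) = lie (from_n4 a) (from_n2_mx b).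
Proof.
apply: (@etrans _ _ (from_n2 0 + from_mx (tensor a b.1))); first by [].
rewrite raddf0 add0r -from_n4_n2.
apply: (@etrans _ _ (lie (from_n4 a) (from_n2 b.1 + from_mx b.2))); last by [].
by rewrite lieDr from_mx_central addr0.
Qed.

Definition from_model : lieHom P L := sd_lift from_model_subproof.

Lemma from_modelE a b c :
  from_model (a, (b, c)) = from_n4 a + (from_n2 b + from_mx c).
Proof. by []. Qed.

Lemma from_n2_image b : exists p, from_n2 b = from_model p.
Proof.
by exists (0, (b, 0)); rewrite from_modelE raddf0 add0r from_mx0 addr0.
Qed.

Lemma from_n4_image a : exists p, from_n4 a = from_model p.
Proof.
by exists (a, (0, 0)); rewrite from_modelE raddf0 from_mx0 !addr0.
Qed.

Local Notation image := (fun l : L => exists p, l = from_model p).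

(** By the triple relation, the set of elements of h whose image under d is
    reached contains the generators and their brackets of length at most
    three; modulo the next term of the central series, these span every term
    of the central series of h. *)
Lemma image_d (x : h) : image (d x).
Proof.
have sI : subalgebra image by apply: subalgebra_image.
have [spI lieI] := sI.
pose Q x := image (d x).
have sQ : subspace Q.
  split=> [|a u v Qu Qv]; first by rewrite /Q (triple_map0 dt); case: spI.
  by rewrite /Q (triple_mapD dt) (triple_mapZ dt); case: spI => _; apply.
have Qx i : Q (x_ i) by rewrite /Q -from_n4E; apply: from_n4_image.
have Qe i j : Q (lie (x_ i) (x_ j)).
  have lt_case (u v : 'I_m) : (u < v)%N -> Q (lie (x_ u) (x_ v)).
    move=> /pr_onto[k pk]; have := from_n2_image (nvar K 2 k).
    by rewrite from_n2E pk.
  case: (ltngtP i j) => [/lt_case //|/lt_case Qji|/val_inj ->].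
    by rewrite lieC; apply: subspaceN.
  by rewrite liexx; case: sQ.
have Qt u v w : Q u -> Q v -> Q w -> Q (lie u (lie v w)).
  by move=> Qu Qv Qw; rewrite /Q -(triple_mapr dt);
    exact: lieI Qu (lieI _ _ Qv Qw).
pose V := lspan (fun x : h => exists i, x = x_ i).
have sV : subspace V by apply: subspace_lspan.
have QV u : V u -> Q u by move=> /(_ Q sQ); apply=> _ [i ->].
have QVV u v : V u -> V v -> Q (lie u v).
  move=> Vu Vv; move: Vu => /(_ (fun u => Q (lie u v))); apply.
    exact: subspace_liel.
  move=> _ [i ->]; move: Vv => /(_ (fun v => Q (lie (x_ i) v))); apply.
    exact: subspace_lier.
  by move=> _ [j ->].
have decomp u : exists v w, [/\ V v, w \in gamma h 2 & u = v + w].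
  refine (nilpotent_gen u
    (P := fun u => exists v w, [/\ V v, w \in gamma h 2 & u = v + w]) _ _).
    split; first split.
    - by exists 0, 0; rewrite rpred0 addr0; split=> //; case: sV.
    - move=> a _ _ [v [w [Vv wG ->]]] [v' [w' [Vv' wG' ->]]].
      exists (a *: v + v'), (a *: w + w'); split; last by lmod.
        by case: sV => _; apply.
      by rewrite rpredD ?rpredZ.
    - move=> s t _ _; exists 0, (lie s t); rewrite add0r gamma2; split=> //.
      by case: sV.
  by move=> _ [i ->]; exists (x_ i), 0; rewrite addr0 rpred0; split=> //;
    apply: lspan_in; exists i.
(* Modulo degree two the entries of a triple bracket may be taken in V, because
   h has class three. *)
have Q3 u : u \in gamma h 3 -> Q u.
  move: u; apply: (gamma_elim sQ) => s.
  have sQ2 := subspace_lier s sQ.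
  apply: (gamma_elim sQ2) => u v _.
  have [s1 [s2 [Vs1 s2G ->]]] := decomp s.
  have [u1 [u2 [Vu1 u2G ->]]] := decomp u.
  have [v1 [v2 [Vv1 v2G ->]]] := decomp v.
  have u2vG : lie u2 (v1 + v2) \in gamma h 3 by rewrite lieC rpredN gammaS.
  rewrite lieDl (h4 (gammaM s2G (gamma2 _ _))) addr0 (lieDl u1)
    (lieDr v1 v2 u1) !(lieDr _ _ s1).
  rewrite (h4 (gammaS s1 (gammaS u1 v2G))) (h4 (gammaS s1 u2vG)) !addr0.
  by apply: Qt; apply: QV.
have Q2 u : u \in gamma h 2 -> Q u.
  move: u; apply: (gamma_elim sQ) => u v _.
  have [u1 [u2 [Vu1 u2G ->]]] := decomp u.
  have [v1 [v2 [Vv1 v2G ->]]] := decomp v.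
  rewrite lieDl; apply: (subspaceD sQ); last first.
    by apply: Q3; rewrite lieC rpredN gammaS.
  rewrite lieDr; apply: (subspaceD sQ); first exact: QVV.
  exact/Q3/gammaS.
have [v [w [Vv wG ->]]] := decomp x.
by apply: (subspaceD sQ); [apply: QV | apply: Q2].
Qed.

Lemma from_model_surj (l : L) : image l.
Proof.
refine (kernel_gen two_neq0 l (subalgebra_image from_model) _).
by move=> _ [x ->]; apply: image_d.
Qed.

Definition to_model_hom : lieHom L P :=
  kernel_lift two_neq0 (to_model_triple two_neq0 pr).

Lemma to_model_homE x : to_model_hom (d x) = to_model pr x.
Proof. exact: kernel_liftE. Qed.

Lemma to_model_n4 a : to_model_hom (from_n4 a) = (a, (0, 0)).
Proof.
refine (nilpotent_gen a (subalgebra_equalizer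
  (lie_comp to_model_hom from_n4) (sd_inl (model_action K m N))) _).
move=> _ [i ->].
change (to_model_hom (from_n4 (nvar K 4 i)) = (nvar K 4 i, (0, 0))).
by rewrite from_n4E to_model_homE to_model_var.
Qed.

Definition n2_in_model_fun (b : n2) : P := (0, (b, 0)).

Lemma n2_in_model_linear : linear n2_in_model_fun.
Proof.
move=> a u v; congr (_, _); first by rewrite /= scaler0 addr0.
by congr (_, _); rewrite /= scaler0 addr0.
Qed.

Lemma n2_in_model_lie : {morph n2_in_model_fun : x y / lie x y >-> lie x y}.
Proof.
move=> x y; congr (_, _); first by rewrite /= lie0x.
congr (_, _); first by rewrite /= subrr add0r.
by rewrite /= !tensor0l subrr abelE addr0.
Qed.

Definition n2_in_model : lieHom n2 P :=
  lie_hom_of n2_in_model_linear n2_in_model_lie.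

Lemma to_model_n2 b : to_model_hom (from_n2 b) = (0, (b, 0)).
Proof.
refine (nilpotent_gen b (subalgebra_equalizer
  (lie_comp to_model_hom from_n2) n2_in_model) _).
move=> _ [k ->].
change (to_model_hom (from_n2 (nvar K 2 k)) = (0, (nvar K 2 k, 0))).
by rewrite from_n2E to_model_homE to_model_bracket.
Qed.

Definition mx_in_model_fun (c : Mx) : P := (0, (0, c)).

Lemma mx_in_model_linear : linear mx_in_model_fun.
Proof.
move=> a u v; congr (_, _); first by rewrite /= scaler0 addr0.
by congr (_, _); rewrite /= scaler0 addr0.
Qed.
HB.instance Definition _ :=
  GRing.isLinear.Build K Mx P _ mx_in_model_fun mx_in_model_linear.

Lemma to_model_mx_delta i k :
  to_model_hom (lie (d (x_ i)) (d (e_ k))) = mx_in_model_fun (delta_mx i k).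
Proof.
rewrite lie_morph !to_model_homE to_model_var // to_model_bracket //.
congr (_, _); first by rewrite /= liex0.
by congr (_, _); rewrite /= ?lie0x ?tensor_var ?tensor0r ?subr0 ?addr0.
Qed.

Lemma to_model_mx c : to_model_hom (from_mx c) = (0, (0, c)).
Proof.
rewrite -[RHS]/(mx_in_model_fun c) [in RHS](matrix_sum_delta c) /from_mx.
rewrite !raddf_sum; apply: eq_bigr => i _; rewrite !raddf_sum.
apply: eq_bigr => k _; apply: etrans (linearZZ to_model_hom _ _) _.
apply: etrans _ (esym (linearZZ mx_in_model_fun _ _)); congr (_ *: _).
exact: to_model_mx_delta.
Qed.

Lemma from_modelK : cancel from_model to_model_hom.
Proof.
have to_modelD l l' : to_model_hom (l + l') = to_model_hom l + to_model_hom l'.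
  exact: raddfD.
case=> a [b c]; rewrite from_modelE !to_modelD.
rewrite to_model_n4 to_model_n2 to_model_mx.
by congr (_, (_, _)); rewrite /= ?addr0 ?add0r.
Qed.

Lemma to_modelK : cancel to_model_hom from_model.
Proof. by move=> l; have [p ->] := from_model_surj l; rewrite from_modelK. Qed.

Definition kernel_proj_fun (l : L) : n4 * n2 :=
  ((to_model_hom l).1, (to_model_hom l).2.1).

Lemma kernel_proj_linear : linear kernel_proj_fun.
Proof. by move=> a u v; rewrite /kernel_proj_fun linearP. Qed.

Lemma kernel_proj_lie : {morph kernel_proj_fun : u v / lie u v >-> lie u v}.
Proof.
move=> u v; rewrite /kernel_proj_fun lie_morph sdlieE.
by congr (_, _); rewrite /= subrr add0r.
Qed.

Definition kernel_proj : lieHom L (n4 * n2)%type :=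
  lie_hom_of kernel_proj_linear kernel_proj_lie.

Definition kernel_section (q : n4 * n2) : L := from_model (q.1, (q.2, 0)).

Lemma kernel_sectionK : cancel kernel_section kernel_proj.
Proof.
move=> q; rewrite /= /kernel_proj_fun /kernel_section from_modelK.
by rewrite -surjective_pairing.
Qed.

Lemma lie_ker_proj (l : L) :
  l \in lie_ker kernel_proj -> l = from_mx (to_model_hom l).2.2.
Proof.
move=> /eqP l0; rewrite -{1}(to_modelK l).
have l1 : (to_model_hom l).1 = 0 := congr1 fst l0.
have l2 : (to_model_hom l).2.1 = 0 := congr1 snd l0.
case: (to_model_hom l) l1 l2 => a [b c] a0 b0.
have -> : a = 0 := a0; have -> : b = 0 := b0.
by rewrite from_modelE !raddf0 !add0r.
Qed.

Lemma from_mx_ker c : from_mx c \in lie_ker kernel_proj.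
Proof. by rewrite unfold_in /= /kernel_proj_fun to_model_mx. Qed.

Lemma central_ker : central (lie_ker kernel_proj : lieIdeal L).
Proof. by move=> l z /lie_ker_proj ->; apply: from_mx_central. Qed.

Lemma has_dim_ker : has_dim (lie_ker kernel_proj : lieIdeal L) (m * N).
Proof.
pose b j := from_mx (vec_mx (delta_mx 0 j)).
have sum_b (c : 'I_(m * N) -> K) :
    \sum_j c j *: b j = from_mx (vec_mx (\row_j c j)).
  rewrite [in RHS](row_sum_delta (\row_j c j)) !raddf_sum.
  apply: eq_bigr => j _; rewrite mxE.
  apply: etrans (esym (linearZZ from_mx _ _)) _.
  exact: (congr1 from_mx (esym (linearZZ vec_mx _ _))).
exists b; split=> [j|c|v /lie_ker_proj ->]; first exact: from_mx_ker.
  rewrite sum_b => /(congr1 to_model_hom); rewrite to_model_mx raddf0.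
  move=> [/(congr1 mxvec)]; rewrite vec_mxK raddf0 => /rowP c0 j.
  by have := c0 j; rewrite !mxE.
exists (fun j => mxvec (to_model_hom v).2.2 0 j).
rewrite sum_b; congr from_mx.
rewrite -[LHS]mxvecK; congr vec_mx; apply/rowP => j; by rewrite mxE.
Qed.

Lemma chi_nilpotent (i j : 'I_m) : i != j -> nilpotent_of_class (chi h) 4.
Proof.
move=> ij; split; first exact: chi_gamma5.
pose x := nvar K 4 i.
pose w := lie x (lie x (lie x (nvar K 4 j))).
have wG : w \in gamma n4 4 by apply/gammaS/gammaS/gamma2.
move=> k k4; exists (kernel_in (from_n4 w)).
  have wG4 := gamma_morph kernel_in (gamma_morph from_n4 wG).
  exact: (gamma_leq (k4 : (k <= 3)%N) wG4).
apply/eqP => w0; have /eqP := free_nilpotent_engel K ij; apply.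
have : to_model_hom (from_n4 w) = 0.
  by rewrite (_ : from_n4 w = 0) ?raddf0 //; apply: kernel_in_inj;
    rewrite w0 raddf0.
by rewrite to_model_n4 => /(congr1 fst).
Qed.

End Isomorphism.

(** * Enumeration of the pairs of generators *)

Lemma ltn_pairs_enum m : exists pr : 'I_('C(m, 2)) -> 'I_m * 'I_m,
  [/\ injective pr, forall k, ((pr k).1 < (pr k).2)%N
    & forall i j : 'I_m, (i < j)%N -> exists k, pr k = (i, j)].
Proof.
pose S := [set p : 'I_m * 'I_m | (p.1 < p.2)%N].
have cardS : #|S| = 'C(m, 2).
  rewrite -sum1dep_card -bin2_sum big_mkord.
  rewrite -(pair_big_dep xpredT (fun i j : 'I_m => (i < j)%N)
    (fun _ _ => 1%N)) /=.
  rewrite (exchange_big_dep xpredT) //=; apply: eq_bigr => j _.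
  rewrite -(big_ord_widen _ (fun=> 1%N) (ltnW (ltn_ord j))).
  by rewrite sum1_card card_ord.
pose pr k := enum_val (cast_ord (esym cardS) k).
have prP k : pr k \in S by apply: enum_valP.
exists pr; split=> [k l /enum_val_inj/cast_ord_inj //|k|i j ij].
  by have := prP k; rewrite inE.
have ijS : (i, j) \in S by rewrite inE.
exists (cast_ord cardS (enum_rank_in ijS (i, j))).
by rewrite /pr cast_ordK enum_rankK_in.
Qed.

Theorem corollary1p3 (K : fieldType) (charK : 2%N \notin [pchar K]) (m : nat) :
  (exists Z : lieIdeal (chi_L (free_nilpotent K m 3)),
    [/\ central Z,
        has_dim Z (m * 'C(m, 2))%N
      & lie_isomorphic (lie_quot Z)
          (free_nilpotent K m 4 * free_nilpotent K 'C(m, 2) 2)%type]) /\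
  ((1 < m)%N -> nilpotent_of_class (chi (free_nilpotent K m 3)) 4).
Proof.
have two_neq0 : (2 : K) != 0 by move: charK; rewrite inE.
have [pr [pr_inj pr_lt pr_onto]] := ltn_pairs_enum m.
split.
  exists (lie_ker (kernel_proj pr two_neq0) : lieIdeal _); split.
  - exact: central_ker.
  - exact: has_dim_ker.
  - exact: lie_ker_iso (kernel_sectionK two_neq0 pr_inj pr_lt).
move=> m1; have m0 := ltnW m1.
exact: (chi_nilpotent pr two_neq0 (i := Ordinal m0) (j := Ordinal m1)).
Qed.
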